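(* In the setting below, let $p_0\in C^1(\mathbb R)$ with $p_0(\xi)=0$ for all $\xi\ge0$, and assume $p_0$ and $p_0'$ are bounded. Let $(p,u)$ be the solution of the Cauchy problem $$p_t+K(x)u_x=0,\qquad u_t+\rho(x)^{-1}p_x=0,\qquad x\in\mathbb R,\ t>0,$$ with initial data $p(x,0)=p_0(x)$ and $u(x,0)=p_0(x)/Z_-$. Then for every $t\ge0$ and every $x\in[0,x_+]$ the two series $\sum_{m\ge0}w^1_{2m+1}(x,t)$ and $\sum_{m\ge0}w^2_{2m}(x,t)$ converge, and $$p(x,t)=\sum_{m=0}^\infty w^1_{2m+1}(x,t)+\sum_{m=0}^\infty w^2_{2m}(x,t).$$ In particular, $p(0,t)-p_0(-c_-t)=\sum_{m\ge0}R_{2m+1}(t)$ and $p(x_+,t)=\sum_{m\ge0}T_{2m}(t)$.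
   Context: Setting. Fix $x_+>0$. Let $K,\rho:\mathbb R\to(0,\infty)$ be continuous, constant $(K_-,\rho_-)$ on $(-\infty,0)$, constant $(K_+,\rho_+)$ on $(x_+,\infty)$, and continuously differentiable on $[0,x_+]$. Define $Z=\sqrt{K\rho}$ and $c=\sqrt{K/\rho}$, with constant values $Z_\pm$, $c_\pm$ outside $[0,x_+]$. Let $r(x)=Z'(x)/(2Z(x))$ on $[0,x_+]$, $\tau(x)=\int_0^x ds/c(s)$, and $C_G(x)=\sqrt{Z(x)/Z_-}$. A sequence $\mathbf x=(x_1,\dots,x_n)$ is alternating if $x_1\ge x_2\le x_3\ge\cdots$, that is, $x_j\le x_{j-1}$ for even $j\ge2$ and $x_j\ge x_{j-1}$ for odd $j\ge3$. Let $\mathcal P_n^{[0,x_+]}$ be the set of alternating $\mathbf x\in[0,x_+]^n$, and put $\hat t(\mathbf x)=2\sum_{j=1}^n(-1)^{j+1}\tau(x_j)$. Define $$\xi_R(\mathbf x,x,t)=-c_-(t-\hat t(\mathbf x)+\tau(x)),\qquad \xi_T(\mathbf x,x,t)=-c_-(t-\hat t(\mathbf x)-\tau(x)).$$ For $x\in[0,x_+]$ and $m\ge0$ define $$w^1_{2m+1}(x,t)=(-1)^mC_G(x)\int_{\mathcal P_{2m}^{[0,x_+]}}\prod_{j=1}^{2m}r(x_j)\int_{\max(x,x_{2m})}^{x_+}p_0\bigl(\xi_R((x_1,\dots,x_{2m+1}),x,t)\bigr)r(x_{2m+1})\,dx_{2m+1}\,dx_1\cdots dx_{2m}.$$ For $m=0$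 read $\max(x,x_0)$ as $x$ and drop the outer integral. For $m\ge1$ define $$w^2_{2m}(x,t)=(-1)^mC_G(x)\int_{\mathcal P_{2m-1}^{[0,x_+]}}\prod_{j=1}^{2m-1}r(x_j)\int_0^{\min(x,x_{2m-1})}p_0\bigl(\xi_T((x_1,\dots,x_{2m}),x,t)\bigr)r(x_{2m})\,dx_{2m}\,dx_1\cdots dx_{2m-1},$$ and set $w^2_0(x,t)=C_G(x)\,p_0(-c_-(t-\tau(x)))$. Finally, $R_{2m+1}(t):=w^1_{2m+1}(0,t)$ and $T_{2m}(t):=w^2_{2m}(x_+,t)$. *)

(* Defs.v *)
From Stdlib Require Import Reals ClassicalEpsilon.
Open Scope R_scope.

(* Riemann integral \int_a^b f (oriented as RiemannInt); its value when f is
   Riemann integrable on [a,b] (all uses below have continuous integrands). *)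
Definition Rint (f : R -> R) (a b : R) : R :=
  epsilon (inhabits 0) (fun v => exists pr : Riemann_integrable f a b, RiemannInt pr = v).

Definition deriv_on (f df : R -> R) (a b : R) : Prop :=
  forall x, a <= x <= b ->
    limit1_in (fun y => (f y - f x) / (y - x)) (fun y => a <= y <= b /\ y <> x) (df x) x.

Definition cont_on (f : R -> R) (a b : R) : Prop :=
  forall x, a <= x <= b -> limit1_in f (fun y => a <= y <= b) (f x) x.

Definition cont2_at (D : R -> R -> Prop) (f : R -> R -> R) (x t : R) : Prop :=
  forall eps, 0 < eps -> exists delta, 0 < delta /\
    forall x' t', D x' t' -> Rabs (x' - x) < delta -> Rabs (t' - t) < delta ->
      Rabs (f x' t' - f x t) < eps.

Definition sgn (j : nat) : R := if Nat.odd j then 1 else -1.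

(* Iterated integral over the alternating simplex P_n^{[0,xp]}.
   Integration variable number j (1-based) ranges over
     [prev, xp]  if j is odd  (prev = 0 for j = 1, since we start with prev = 0),
     [0, prev]   if j is even,
   where prev = x_{j-1}.  acc accumulates sum_{i<j} (-1)^(i+1) tau(x_i),
   prd accumulates prod_{i<j} r(x_i); G receives (x_n, acc, prd) at the end. *)
Fixpoint alt_iter (xp : R) (tau r : R -> R) (n j : nat) (prev acc prd : R)
  (G : R -> R -> R -> R) : R :=
  match n with
  | O => G prev acc prd
  | S n' =>
      Rint (fun y => alt_iter xp tau r n' (S j) y (acc + sgn j * tau y) (prd * r y) G)
           (if Nat.odd j then prev else 0)
           (if Nat.odd j then xp else prev)
  end.

Section Coeffs.
(* K, rho, the left constants Km rm, x_+ = xp, derivative dZ of Z on [0,xp] *)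
Variables (K rho : R -> R) (Km rm xp : R) (dZ : R -> R) (p0 : R -> R).

Definition Zf (x : R) : R := sqrt (K x * rho x).
Definition cf (x : R) : R := sqrt (K x / rho x).
Definition Zm : R := sqrt (Km * rm).
Definition cm : R := sqrt (Km / rm).
Definition rf (x : R) : R := dZ x / (2 * Zf x).
Definition tauf (x : R) : R := Rint (fun s => / cf s) 0 x.
Definition CG (x : R) : R := sqrt (Zf x / Zm).

Definition w1 (m : nat) (x t : R) : R :=
  (-1) ^ m * CG x *
  alt_iter xp tauf rf (2 * m) 1 0 0 1
    (fun prev acc prd =>
       prd * Rint (fun y => p0 (- cm * (t - 2 * (acc + tauf y) + tauf x)) * rf y)
                  (Rmax x prev) xp).

Definition w2 (m : nat) (x t : R) : R :=
  match m with
  | O => CG x * p0 (- cm * (t - tauf x))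
  | S _ =>
    (-1) ^ m * CG x *
    alt_iter xp tauf rf (2 * m - 1) 1 0 0 1
      (fun prev acc prd =>
         prd * Rint (fun y => p0 (- cm * (t - 2 * (acc - tauf y) - tauf x)) * rf y)
                    0 (Rmin x prev))
  end.
End Coeffs.

(* Main.v *)
(** In the Riemann invariants [(p / sqrt Z + sigma sqrt Z u) / 2], [sigma = 1, -1],
    the system reads, along the characteristics of speed [sigma c], as an exchange
    of the two waves at rate [r]. To the left of [0] and to the right of [x_+] the
    invariants are merely transported, so the right-going wave enters at [0] with
    the known profile [p0 (- c_- t) / sqrt Z_-] and no left-going wave enters at
    [x_+]. Integrating along characteristics gives the Volterra system
    [F = entry + right_op G], [G = left_op F] on [[0, x_+]]. Its Picard iterates
    converge geometrically, because both operators contract by 1/2 in the norm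
    weighted by [exp (- lam t)] with [lam] large; no smallness of [r] is needed.
    The n-th iterates are, up to the factor [sqrt Z], the terms [w^1] and [w^2]: the
    iterates peel off the last variable of the alternating simplex while [alt_iter]
    integrates the first variable outermost, and Fubini's theorem relates the two. *)
Require Import Defs.
From Stdlib Require Import Reals Lra Lia ClassicalEpsilon FunctionalExtensionality.
From Coquelicot Require Import Coquelicot.
Open Scope R_scope.

(** * Continuous integrands and Fubini's theorem *)

(** The solution is given, so no fixed point has to be constructed: the quantity estimated is the
    difference between its invariants and the partial sums. By linearity these remainders satisfy
    the same system without the entry term, so convergence and the value of the sum come out
    together. Freezing the data at negative times makes both invariants vanish on [[0, xp]] for t <=
    0. Every characteristic can then be followed back to 0 or [xp] with no case distinction on where
    it meets t = 0, and the weighted norm is finite on all times up to T. Z may have corners at 0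
    and [xp], so the transport equations are integrated separately inside and outside and joined by
    continuity of the invariants. The factor 1/2 comes from lam >= 2 Q, where Q bounds |r| c: the
    integral of |r| exp (lam s) along a characteristic ending at time t is at most Q / lam times exp
    (lam t). *)

Definition cts {U V : UniformSpace} (f : U -> V) : Prop := forall u, continuous f u.

Lemma cts_const {U V : UniformSpace} (c : V) : cts (fun _ : U => c).
Proof. intros u; apply continuous_const. Qed.

Lemma cts_id {U : UniformSpace} : cts (fun u : U => u).
Proof. intros u; apply continuous_id. Qed.

Lemma cts_fst {U V W : UniformSpace} (f : U -> V * W) :
  cts f -> cts (fun u => fst (f u)).
Proof.
  intros Hf u; apply (continuous_comp f fst); [apply Hf|].
  destruct (f u); apply continuous_fst.
Qed.

Lemma cts_snd {U V W : UniformSpace} (f : U -> V * W) :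
  cts f -> cts (fun u => snd (f u)).
Proof.
  intros Hf u; apply (continuous_comp f snd); [apply Hf|].
  destruct (f u); apply continuous_snd.
Qed.

Lemma cts_plus {U : UniformSpace} (f g : U -> R) :
  cts f -> cts g -> cts (fun u => f u + g u).
Proof. intros Hf Hg u; apply (continuous_plus f g); [apply Hf|apply Hg]. Qed.

Lemma cts_minus {U : UniformSpace} (f g : U -> R) :
  cts f -> cts g -> cts (fun u => f u - g u).
Proof. intros Hf Hg u; apply (continuous_minus f g); [apply Hf|apply Hg]. Qed.

Lemma cts_opp {U : UniformSpace} (f : U -> R) : cts f -> cts (fun u => - f u).
Proof. intros Hf u; apply (continuous_opp f), Hf. Qed.

Lemma cts_mult {U : UniformSpace} (f g : U -> R) :
  cts f -> cts g -> cts (fun u => f u * g u).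
Proof. intros Hf Hg u; apply (continuous_mult f g); [apply Hf|apply Hg]. Qed.

Lemma cts_comp {U V W : UniformSpace} (g : V -> W) (f : U -> V) :
  cts g -> cts f -> cts (fun u => g (f u)).
Proof. intros Hg Hf u; apply (continuous_comp f g); [apply Hf|apply Hg]. Qed.

Lemma cts_pair {U V W : UniformSpace} (f : U -> V) (g : U -> W) :
  cts f -> cts g -> cts (fun u => (f u, g u)).
Proof.
  intros Hf Hg u.
  apply (continuous_comp_2 f g pair); [apply Hf|apply Hg|].
  intros P [e He]; exists e; intros [a b] H; apply He, H.
Qed.

Lemma cts_comp2 {U V W X : UniformSpace} (h : V -> W -> X) (f : U -> V) (g : U -> W) :
  cts (fun z : V * W => h (fst z) (snd z)) -> cts f -> cts g ->
  cts (fun u => h (f u) (g u)).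
Proof.
  intros Hh Hf Hg.
  apply (cts_comp (fun z : V * W => h (fst z) (snd z)) (fun u => (f u, g u)));
    [exact Hh|apply cts_pair; assumption].
Qed.

Lemma cts_comp3 {U V W X Y : UniformSpace} (h : V -> W -> X -> Y)
    (f : U -> V) (g : U -> W) (k : U -> X) :
  cts (fun z : V * (W * X) => h (fst z) (fst (snd z)) (snd (snd z))) ->
  cts f -> cts g -> cts k -> cts (fun u => h (f u) (g u) (k u)).
Proof.
  intros Hh Hf Hg Hk.
  apply (cts_comp (fun z : V * (W * X) => h (fst z) (fst (snd z)) (snd (snd z)))
    (fun u => (f u, (g u, k u)))); [exact Hh|].
  apply cts_pair; [|apply cts_pair]; assumption.
Qed.

Lemma cts_of_continuity (f : R -> R) : continuity f -> cts f.
Proof. intros H u; apply continuity_pt_filterlim, H. Qed.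

Lemma cts_continuity (f : R -> R) : cts f -> continuity f.
Proof. intros H u; apply continuity_pt_filterlim, H. Qed.

Lemma cts_abs {U : UniformSpace} (f : U -> R) : cts f -> cts (fun u => Rabs (f u)).
Proof. apply (cts_comp Rabs), cts_of_continuity, Rcontinuity_abs. Qed.

Lemma cts_max {U : UniformSpace} (f g : U -> R) :
  cts f -> cts g -> cts (fun u => Rmax (f u) (g u)).
Proof.
  intros Hf Hg u.
  apply (continuous_ext (fun u => / 2 * (f u + g u + Rabs (f u - g u)))).
  - intros v; unfold Rmax, Rabs; destruct (Rle_dec _ _), (Rcase_abs _); lra.
  - revert u; apply cts_mult; [apply cts_const|].
    apply cts_plus; [apply cts_plus; assumption|apply cts_abs, cts_minus; assumption].
Qed.

Lemma cts_min {U : UniformSpace} (f g : U -> R) :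
  cts f -> cts g -> cts (fun u => Rmin (f u) (g u)).
Proof.
  intros Hf Hg u.
  apply (continuous_ext (fun u => - Rmax (- f u) (- g u))).
  - intros v; unfold Rmax, Rmin; destruct (Rle_dec _ _), (Rle_dec _ _); lra.
  - revert u; apply cts_opp, cts_max; apply cts_opp; assumption.
Qed.

Lemma cts_inv {U : UniformSpace} (f : U -> R) :
  (forall u, f u <> 0) -> cts f -> cts (fun u => / f u).
Proof.
  intros H0 Hf u; apply (continuous_comp f Rinv); [apply Hf|].
  apply continuity_pt_filterlim.
  apply (continuity_pt_inv (fun x => x)); [apply continuity_pt_id|apply H0].
Qed.

Lemma cts_sqrt {U : UniformSpace} (f : U -> R) :
  cts f -> cts (fun u => sqrt (f u)).
Proof. intros Hf u; apply (continuous_comp f sqrt); [apply Hf|apply continuous_sqrt]. Qed.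

Lemma cts_ex_RInt (f : R -> R) (a b : R) : cts f -> ex_RInt f a b.
Proof. intros H; apply (ex_RInt_continuous f); intros z _; apply H. Qed.

(** Compactness of [[a, b]] makes continuity in the parameter uniform in [t]; this is what lets the
    limit pass under the integral in [cts_RInt_const]. *)
Lemma tube {U : UniformSpace} (f : U -> R -> R) (a b : R) (u : U) (eps : R) :
  0 < eps ->
  cts (fun z : U * R => f (fst z) (snd z)) ->
  locally u (fun u' => forall t, a <= t <= b -> Rabs (f u' t - f u t) < eps).
Proof.
  intros He Hf.
  assert (H : forall t, exists d : posreal, forall u' t', ball u d u' -> ball t d t' ->
      Rabs (f u' t' - f u t) < eps / 2).
  { intros t.
    destruct (proj1 (filterlim_locally _ _) (Hf (u, t)) (mkposreal (eps / 2) ltac:(lra))) as [d Hd].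
    exists d; intros u' t' H1 H2. apply (Hd (u', t')). split; assumption. }
  assert (Hd : exists delta : R -> posreal, forall t u' t', ball u (delta t) u' ->
      ball t (delta t) t' -> Rabs (f u' t' - f u t) < eps / 2).
  { exists (fun t => proj1_sig (constructive_indefinite_description _ (H t))).
    intros t; destruct (constructive_indefinite_description _ (H t)); assumption. }
  destruct Hd as [delta Hd].
  destruct (compactness_value_1d a b delta) as [d Hc].
  exists d; intros u' Hu t Ht.
  (* [compactness_value_1d] gives the centre of the covering interval only under a double negation,
     so the inequality is decided first and its failure refuted. *)
  destruct (Rlt_dec (Rabs (f u' t - f u t)) eps) as [|Hn]; [assumption|exfalso].
  apply (Hc t Ht); intros [s [_ [Hs1 Hs2]]]; apply Hn.
  assert (B : ball s (delta s) t) by exact Hs1.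
  assert (H1 := Hd s u' t (ball_le u d (delta s) Hs2 u' Hu) B).
  assert (H2 := Hd s u t (ball_center u (delta s)) B).
  replace (f u' t - f u t) with ((f u' t - f u s) - (f u t - f u s)) by ring.
  eapply Rle_lt_trans; [apply Rabs_triang|]. rewrite Rabs_Ropp. lra.
Qed.

Lemma cts_slice {U V W : UniformSpace} (f : U -> V -> W) (u : U) :
  cts (fun z : U * V => f (fst z) (snd z)) -> cts (f u).
Proof. intros H; apply (cts_comp2 f (fun _ => u) (fun v => v) H); [apply cts_const|apply cts_id]. Qed.

Lemma cts_RInt_const {U : UniformSpace} (f : U -> R -> R) :
  cts (fun z : U * R => f (fst z) (snd z)) -> cts (fun u => RInt (f u) 0 1).
Proof.
  intros Hf u. apply filterlim_locally; intros eps.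
  generalize (tube f 0 1 u (eps / 2) ltac:(destruct eps; simpl; lra) Hf).
  apply filter_imp; intros u' H.
  change (norm (minus (RInt (V := R_CompleteNormedModule) (f u') 0 1) (RInt (V := R_CompleteNormedModule) (f u) 0 1)) < eps).
  assert (E1 : ex_RInt (f u') 0 1) by apply cts_ex_RInt, (cts_slice f), Hf.
  assert (E2 : ex_RInt (f u) 0 1) by apply cts_ex_RInt, (cts_slice f), Hf.
  assert (E := ex_RInt_minus (V := R_NormedModule) (f u') (f u) 0 1 E1 E2).
  rewrite <- (RInt_minus (V := R_CompleteNormedModule) (f u') (f u) 0 1 E1 E2).
  assert (B : norm (RInt (fun x => minus (f u' x) (f u x)) 0 1) <= (1 - 0) * (eps / 2)).
  { apply (norm_RInt_le_const (V := R_NormedModule)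
      (fun x => minus (f u' x) (f u x)) 0 1 _ _ ltac:(lra)).
    - intros x Hx; left; apply (H x Hx).
    - apply (RInt_correct (V := R_CompleteNormedModule)), E. }
  eapply Rle_lt_trans; [exact B|]. destruct eps; simpl; lra.
Qed.

(* Turns moving endpoints into a parameter of the integrand. *)
Lemma RInt_rescale (f : R -> R) (a b : R) :
  cts f -> RInt f a b = (b - a) * RInt (fun s => f ((b - a) * s + a)) 0 1.
Proof.
  intros Hf.
  assert (H := RInt_comp_lin (V := R_CompleteNormedModule) f (b - a) a 0 1 (cts_ex_RInt f _ _ Hf)).
  replace ((b - a) * 0 + a) with a in H by ring.
  replace ((b - a) * 1 + a) with b in H by ring.
  rewrite <- H.
  apply (RInt_scal (V := R_CompleteNormedModule) (fun s => f ((b - a) * s + a)) 0 1 (b - a)).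
  apply cts_ex_RInt, (cts_comp f); [exact Hf|].
  apply cts_plus; [apply cts_mult|]; try apply cts_const; apply cts_id.
Qed.

Lemma cts_RInt {U : UniformSpace} (f : U -> R -> R) (a b : U -> R) :
  cts (fun z : U * R => f (fst z) (snd z)) -> cts a -> cts b ->
  cts (fun u => RInt (f u) (a u) (b u)).
Proof.
  intros Hf Ha Hb u.
  apply (continuous_ext (fun u => (b u - a u) *
    RInt (fun s => f u ((b u - a u) * s + a u)) 0 1)).
  - intros v; symmetry; apply RInt_rescale, (cts_slice f), Hf.
  - revert u; apply cts_mult; [apply cts_minus; assumption|].
    apply (cts_RInt_const (fun u s => f u ((b u - a u) * s + a u))).
    apply (cts_comp2 f fst); [exact Hf|apply cts_fst, cts_id|].
    assert (A : cts (fun z : U * R => a (fst z))) by (apply (cts_comp a), cts_fst, cts_id; assumption).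
    assert (B : cts (fun z : U * R => b (fst z))) by (apply (cts_comp b), cts_fst, cts_id; assumption).
    apply cts_plus; [apply cts_mult; [apply cts_minus|apply cts_snd, cts_id]|]; assumption.
Qed.

(* The radius of continuity is shrunk below [/ (|f x y| + 1)], so that the uniform
   radius supplied by compactness also bounds [f]. *)
Lemma cts_bounded2 (f : R -> R -> R) (a b c d : R) :
  cts (fun z : R * R => f (fst z) (snd z)) ->
  exists M, forall x y, a <= x <= b -> c <= y <= d -> Rabs (f x y) <= M.
Proof.
  intros Hf.
  assert (H : forall x y, exists e : posreal, (forall x' y', ball x e x' -> ball y e y' ->
      Rabs (f x' y' - f x y) < 1) /\ Rabs (f x y) <= / e).
  { intros x y.
    destruct (proj1 (filterlim_locally _ _) (Hf (x, y)) (mkposreal 1 Rlt_0_1)) as [e He].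
    assert (P : 0 < / (Rabs (f x y) + 1)).
    { apply Rinv_0_lt_compat. assert (A := Rabs_pos (f x y)); lra. }
    assert (Q : 0 < Rmin e (/ (Rabs (f x y) + 1))) by (apply Rmin_pos; [apply cond_pos|exact P]).
    exists (mkposreal _ Q); split.
    - intros x' y' H1 H2. apply (He (x', y')). split; simpl in *.
      + eapply ball_le; [|exact H1]. apply Rmin_l.
      + eapply ball_le; [|exact H2]. apply Rmin_l.
    - simpl. apply Rle_trans with (Rabs (f x y) + 1); [lra|].
      apply Rle_trans with (/ / (Rabs (f x y) + 1)); [rewrite Rinv_inv; lra|].
      apply Rinv_le_contravar; [exact Q|apply Rmin_r]. }
  set (delta := fun x y => proj1_sig (constructive_indefinite_description _ (H x y))).
  assert (Hd : forall x y, (forall x' y', ball x (delta x y) x' -> ball y (delta x y) y' ->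
      Rabs (f x' y' - f x y) < 1) /\ Rabs (f x y) <= / delta x y).
  { intros x y; unfold delta; destruct (constructive_indefinite_description _ (H x y)); assumption. }
  destruct (compactness_value_2d a b c d delta) as [e He].
  exists (/ e + 1); intros x y Hx Hy.
  destruct (Rle_dec (Rabs (f x y)) (/ e + 1)) as [|Hn]; [assumption|exfalso].
  apply (He x y Hx Hy); intros [u [v [_ [_ [H1 [H2 H3]]]]]]; apply Hn.
  destruct (Hd u v) as [D1 D2].
  assert (D := D1 x y H1 H2).
  assert (Hi : / delta u v <= / e) by (apply Rinv_le_contravar; [apply cond_pos|exact H3]).
  replace (f x y) with ((f x y - f u v) + f u v) by ring.
  eapply Rle_trans; [apply Rabs_triang|]. lra.
Qed.

Definition cts2 {U V W : UniformSpace} (f : U -> V -> W) : Prop :=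
  cts (fun z : U * V => f (fst z) (snd z)).

(** The patterns with a partially applied operator, such as [Rmax ?a], catch goals in eta-contracted
    form. *)
Ltac cts_step :=
  cbv beta;
  match goal with
  | H : cts ?f |- cts ?f => exact H
  | H : cts2 ?f |- cts2 ?f => exact H
  | |- cts (fun _ => _) => apply cts_const
  | |- cts (fun u => u) => apply cts_id
  | |- cts fst => apply (cts_fst (fun z => z))
  | |- cts snd => apply (cts_snd (fun z => z))
  | |- cts (Rmax ?a) => apply (cts_max (fun _ => a) (fun z => z))
  | |- cts (Rplus ?a) => apply (cts_plus (fun _ => a) (fun z => z))
  | |- cts (Rmult ?a) => apply (cts_mult (fun _ => a) (fun z => z))
  | |- cts (fun u => fst _) => apply cts_fst
  | |- cts (fun u => snd _) => apply cts_snd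
  | |- cts (fun u => _ + _) => apply cts_plus
  | |- cts (fun u => _ - _) => apply cts_minus
  | |- cts (fun u => - _) => apply cts_opp
  | |- cts (fun u => _ * _) => apply cts_mult
  | |- cts (fun u => Rmax _ _) => apply cts_max
  | |- cts (fun u => Rmin _ _) => apply cts_min
  | |- cts (fun u => Rabs _) => apply cts_abs
  | H : cts ?f |- cts (fun u => ?f (@?g u)) => apply (cts_comp f g H)
  | H : cts2 ?f |- cts (fun u => ?f (@?g u) (@?h u)) => apply (cts_comp2 f g h H)
  end.

Ltac ctsx := repeat cts_step.

(** * Differentiation of parametric integrals and exchange of the order of integration *)

Lemma RInt_ext_R (f g : R -> R) (a b : R) :
  (forall y, Rmin a b < y < Rmax a b -> f y = g y) -> RInt f a b = RInt g a b.
Proof. apply (RInt_ext (V := R_CompleteNormedModule)). Qed.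

Lemma cts2_swap {U V W : UniformSpace} (f : U -> V -> W) :
  cts2 f -> cts2 (fun v u => f u v).
Proof. intros Hf; apply (cts_comp2 f snd fst); [exact Hf| |]; ctsx. Qed.

Lemma is_derive_RInt_cts (f : R -> R) (a b : R) :
  cts f -> is_derive (fun q => RInt f a q) b (f b).
Proof.
  intros Hf. apply (is_derive_RInt (V := R_NormedModule) f (fun q => RInt f a q) a b); [|apply Hf].
  apply filter_forall; intros q; apply (RInt_correct (V := R_CompleteNormedModule)).
  apply cts_ex_RInt, Hf.
Qed.

(** The tool behind both exchange formulas below: as functions of a moving limit, the two sides have
    the same derivative and agree at its initial position. *)
Lemma eq_of_derive (f g d : R -> R) (a b : R) :
  a <= b ->
  (forall x, a <= x <= b -> is_derive f x (d x)) ->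
  (forall x, a <= x <= b -> is_derive g x (d x)) ->
  f a = g a -> f b = g b.
Proof.
  intros Hab Hf Hg E.
  destruct (MVT_gen (fun x => f x - g x) a b (fun _ => 0)) as [c [_ Hc]].
  - rewrite Rmin_left, Rmax_right by lra. intros x Hx.
    replace 0 with (d x - d x) by ring.
    apply (is_derive_minus (V := R_NormedModule) f g); [apply Hf|apply Hg]; lra.
  - rewrite Rmin_left, Rmax_right by lra. intros x Hx.
    apply continuity_pt_filterlim, (continuous_minus (V := R_NormedModule) f g);
      apply (ex_derive_continuous (V := R_NormedModule)); eexists; [apply Hf|apply Hg]; lra.
  - lra.
Qed.

Lemma cts2_continuity_2d_pt (h : R -> R -> R) (x y : R) :
  cts2 h -> continuity_2d_pt h x y.
Proof. intros Hh; apply continuity_2d_pt_filterlim, (Hh (x, y)). Qed.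

Lemma cts2_RInt_upper (h : R -> R -> R) (c : R) :
  cts2 h -> cts2 (fun q y => RInt (fun x => h x y) c q).
Proof.
  intros Hh.
  apply (cts_RInt (fun (z : R * R) x => h x (snd z)) (fun _ => c) fst); [|ctsx|ctsx].
  ctsx.
Qed.

Lemma is_derive_RInt_upper_param (h : R -> R -> R) (a c d q : R) :
  cts2 h ->
  is_derive (fun q => RInt (fun y => RInt (fun x => h x y) a q) c d) q
    (RInt (h q) c d).
Proof.
  intros Hh.
  assert (D : forall q y, is_derive (fun z => RInt (fun x => h x y) a z) q (h q y)).
  { intros q' y; apply (is_derive_RInt_cts (fun x => h x y)).
    apply (cts_slice (fun y x => h x y)), (cts2_swap h), Hh. }
  rewrite <- (RInt_ext (V := R_CompleteNormedModule)
    (fun y => Derive (fun u => RInt (fun x => h x y) a u) q) (h q)).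
  2: { intros y _; apply is_derive_unique, D. }
  apply (is_derive_RInt_param (fun q y => RInt (fun x => h x y) a q)).
  - apply filter_forall; intros x y _; eexists; apply D.
  - intros y _. apply (continuity_2d_pt_ext h).
    + intros u v; symmetry; apply is_derive_unique, D.
    + apply cts2_continuity_2d_pt, Hh.
  - apply filter_forall; intros x.
    apply cts_ex_RInt, (cts_slice (fun q y => RInt (fun x => h x y) a q)), cts2_RInt_upper, Hh.
Qed.

Lemma RInt_swap_le (h : R -> R -> R) (a b c d : R) :
  cts2 h -> a <= b ->
  RInt (fun x => RInt (h x) c d) a b = RInt (fun y => RInt (fun x => h x y) a b) c d.
Proof.
  intros Hh Hab.
  apply (eq_of_derive (fun b => RInt (fun x => RInt (h x) c d) a b)
    (fun b => RInt (fun y => RInt (fun x => h x y) a b) c d) (fun q => RInt (h q) c d) a b Hab).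
  - intros q _; apply (is_derive_RInt_cts (fun x => RInt (h x) c d)).
    apply (cts_RInt h); ctsx; exact Hh.
  - intros q _; apply is_derive_RInt_upper_param, Hh.
  - rewrite RInt_point. symmetry.
    erewrite RInt_ext; [|intros y _; apply RInt_point].
    rewrite RInt_const. apply (scal_zero_r (V := R_NormedModule)).
Qed.

(** Leibniz rule with [q] both as parameter and as lower limit; the latter contributes the boundary
    term [- k q q]. *)
Lemma is_derive_RInt_lower_param (k dk : R -> R -> R) (X q : R) :
  (forall y q, is_derive (fun z => k y z) q (dk y q)) ->
  cts2 k -> cts2 dk ->
  is_derive (fun q => RInt (fun y => k y q) q X) q
    (RInt (fun y => dk y q) q X - k q q).
Proof.
  intros D Hk Hdk.
  assert (C : forall x y, continuity_2d_pt (fun u v => Derive (fun z => k v z) u) x y).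
  { intros x y; apply (continuity_2d_pt_ext (fun u v => dk v u)).
    - intros u v; symmetry; apply is_derive_unique, D.
    - apply cts2_continuity_2d_pt, (cts2_swap dk), Hdk. }
  assert (S : forall q, cts (fun y => k y q)).
  { intros z; apply (cts_slice (fun q y => k y q)), (cts2_swap k), Hk. }
  replace (RInt (fun y => dk y q) q X - k q q) with
    (RInt (fun t => Derive (fun u => k t u) q) q X + - k q q * 1 + k X q * 0).
  2: { rewrite (RInt_ext (V := R_CompleteNormedModule)
        (fun t => Derive (fun u => k t u) q) (fun y => dk y q)); [ring|].
       intros y _; apply is_derive_unique, D. }
  apply (is_derive_RInt_param_bound_comp (fun q y => k y q) (fun q => q) (fun _ => X)).
  - apply filter_forall; intros z; apply cts_ex_RInt, S.
  - exists (mkposreal 1 Rlt_0_1); apply filter_forall; intros z; apply cts_ex_RInt, S.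
  - exists (mkposreal 1 Rlt_0_1); apply filter_forall; intros z; apply cts_ex_RInt, S.
  - apply (is_derive_id (K := R_AbsRing)).
  - apply (is_derive_const (V := R_NormedModule)).
  - exists (mkposreal 1 Rlt_0_1); apply filter_forall; intros z t _; eexists; apply D.
  - intros t _; apply C.
  - apply locally_2d_forall; intros; apply C.
  - apply locally_2d_forall; intros; apply C.
  - apply cts_continuity, S.
  - apply cts_continuity, S.
Qed.

(** Both sides integrate over the region x <= y <= X, c <= z <= min (y, q), sliced once in y and
    once in z. For q <= x it is a rectangle; beyond x the two sides are compared by differentiating
    in q. This exchange is the source of the [Rmax] and [Rmin] in the limits of w^1 and w^2. *)
Lemma RInt_triangle_swap (h : R -> R -> R) (c x X q : R) :
  cts2 h -> c <= x <= X -> c <= q <= X ->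
  RInt (fun y => RInt (h y) c (Rmin y q)) x X =
  RInt (fun z => RInt (fun y => h y z) (Rmax x z) X) c q.
Proof.
  intros Hh Hx Hq.
  assert (Rect : forall q', c <= q' <= x ->
    RInt (fun y => RInt (h y) c q') x X =
    RInt (fun z => RInt (fun y => h y z) (Rmax x z) X) c q').
  { intros q' H'.
    rewrite RInt_swap_le; [|exact Hh|lra].
    apply (RInt_ext (V := R_CompleteNormedModule)); intros z Hz.
    rewrite Rmin_left, Rmax_right in Hz by lra.
    rewrite Rmax_left by lra; reflexivity. }
  destruct (Rle_dec q x) as [H|H].
  { rewrite <- Rect by lra.
    apply (RInt_ext (V := R_CompleteNormedModule)); intros y Hy.
    rewrite Rmin_left, Rmax_right in Hy by lra.
    rewrite Rmin_right by lra; reflexivity. }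
  set (k := fun y q => RInt (h y) c q).
  assert (Hk : cts2 k) by apply cts2_swap, (cts2_RInt_upper (fun z y => h y z)), cts2_swap, Hh.
  assert (Dk : forall y q, is_derive (fun z => k y z) q (h y q)).
  { intros y z; apply is_derive_RInt_cts, (cts_slice h), Hh. }
  assert (Hkk : cts (fun y => k y y)) by (apply (cts_comp2 k); [exact Hk| |]; ctsx).
  assert (Hkq : forall z, cts (fun y => k y z)) by (intros z; apply (cts_comp2 k); [exact Hk| |]; ctsx).
  (* Splitting at y = q resolves [Rmin y q] on each piece. *)
  transitivity (RInt (fun y => k y y) x q + RInt (fun y => k y q) q X).
  { rewrite <- (RInt_Chasles (V := R_CompleteNormedModule)
      (fun y => RInt (h y) c (Rmin y q)) x q X).
    - apply (f_equal2 Rplus); apply (RInt_ext (V := R_CompleteNormedModule)); intros y Hy;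
        rewrite Rmin_left, Rmax_right in Hy by lra.
      + rewrite Rmin_left by lra; reflexivity.
      + rewrite Rmin_right by lra; reflexivity.
    - apply cts_ex_RInt, (cts_comp2 k); [exact Hk| |]; ctsx.
    - apply cts_ex_RInt, (cts_comp2 k); [exact Hk| |]; ctsx. }
  apply (eq_of_derive (fun q => RInt (fun y => k y y) x q + RInt (fun y => k y q) q X)
    (fun q => RInt (fun z => RInt (fun y => h y z) (Rmax x z) X) c q)
    (fun q => RInt (fun y => h y q) q X) x q); [lra| | |].
  - intros z Hz.
    (* The growth [k z z] of the first piece cancels the boundary term lost by the second. *)
    replace (RInt (fun y => h y z) z X) with (k z z + (RInt (fun y => h y z) z X - k z z)) by ring.
    apply (is_derive_plus (V := R_NormedModule)
      (fun q => RInt (fun y => k y y) x q) (fun q => RInt (fun y => k y q) q X)).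
    + apply (is_derive_RInt_cts (fun y => k y y)), Hkk.
    + apply is_derive_RInt_lower_param; assumption.
  - intros z Hz. rewrite <- (Rmax_right x z) at 2 by lra.
    apply (is_derive_RInt_cts (fun z => RInt (fun y => h y z) (Rmax x z) X)).
    apply (cts_RInt (fun z y => h y z)); ctsx.
  - rewrite RInt_point. rewrite <- Rect by lra. apply (Rplus_0_l).
Qed.

(** * The integral [Rint] of the statement, and elementary estimates *)

Lemma Rint_RInt (f : R -> R) (a b : R) : ex_RInt f a b -> Rint f a b = RInt f a b.
Proof.
  intros E; unfold Rint.
  destruct (epsilon_spec (inhabits 0) (fun v => exists pr : Riemann_integrable f a b, RiemannInt pr = v))
    as [pr Hpr].
  - exists (RiemannInt (ex_RInt_Reals_0 _ _ _ E)), (ex_RInt_Reals_0 _ _ _ E); reflexivity.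
  - rewrite <- Hpr; symmetry; apply RInt_Reals.
Qed.

(** Agreement on the open interval suffices, so the integrand may be replaced by a continuous one
    that differs from it at the endpoints. *)
Lemma Rint_cts (f g : R -> R) (a b : R) :
  cts g -> (forall y, Rmin a b < y < Rmax a b -> f y = g y) -> Rint f a b = RInt g a b.
Proof.
  intros Hg E. rewrite Rint_RInt.
  - apply RInt_ext_R, E.
  - apply (ex_RInt_ext g); [intros y Hy; symmetry; apply E, Hy|apply cts_ex_RInt, Hg].
Qed.

Lemma RInt_ext_le (f g : R -> R) (a b : R) :
  a <= b -> (forall y, a <= y <= b -> f y = g y) -> RInt f a b = RInt g a b.
Proof.
  intros Hab E; apply RInt_ext_R; intros y Hy.
  rewrite Rmin_left, Rmax_right in Hy by lra. apply E; lra.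
Qed.

Lemma RInt_mult_l (f : R -> R) (a b k : R) :
  cts f -> RInt (fun y => k * f y) a b = k * RInt f a b.
Proof. intros Hf; apply (RInt_scal (V := R_CompleteNormedModule) f a b k), cts_ex_RInt, Hf. Qed.

Lemma increasing_of_derive (f df : R -> R) (x y : R) :
  (forall z, is_derive f z (df z)) -> (forall z, 0 < df z) -> x < y -> f x < f y.
Proof.
  intros D P H.
  destruct (MVT_gen f x y df) as [c [_ Hc]].
  - intros z _; apply D.
  - intros z _; apply continuity_pt_filterlim, (ex_derive_continuous (V := R_NormedModule)).
    eexists; apply D.
  - assert (A := P c); nra.
Qed.

Lemma abs_RInt_le_derive (f F dF : R -> R) (a b : R) :
  a <= b -> cts f -> cts dF ->
  (forall y, is_derive F y (dF y)) ->
  (forall y, a <= y <= b -> Rabs (f y) <= dF y) ->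
  Rabs (RInt f a b) <= F b - F a.
Proof.
  intros Hab Hf HdF D B.
  eapply Rle_trans; [apply abs_RInt_le; [exact Hab|apply cts_ex_RInt, Hf]|].
  replace (F b - F a) with (RInt dF a b).
  - apply RInt_le; [exact Hab| | |].
    + apply cts_ex_RInt, cts_abs, Hf.
    + apply cts_ex_RInt, HdF.
    + intros y Hy; apply B; lra.
  - apply (is_RInt_unique (V := R_CompleteNormedModule)).
    apply (is_RInt_derive (V := R_CompleteNormedModule) F dF); intros y _; [apply D|apply HdF].
Qed.

(** * Iterated integrals over the alternating simplex *)

Section Alternating.

Variables (xp : R) (tau rr phi : R -> R).
Hypothesis xp_pos : 0 < xp.
Hypothesis cts_tau : cts tau.
Hypothesis cts_rr : cts rr.
Hypothesis cts_phi : cts phi.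

Definition alt_lo (j : nat) (prev : R) : R := if Nat.odd j then prev else 0.
Definition alt_hi (j : nat) (prev : R) : R := if Nat.odd j then xp else prev.

(* [alt_iter] on continuous integrands: the product of the [r x_j] is moved inside the
   integrals, and [r] is replaced by an extension [rr] continuous on the whole line. *)
Fixpoint alt (n j : nat) (g : R -> R -> R) (prev acc : R) : R :=
  match n with
  | O => g prev acc
  | S n' => RInt (fun y => rr y * alt n' (S j) g y (acc + sgn j * tau y)) (alt_lo j prev) (alt_hi j prev)
  end.

Definition cts3 {U V W X : UniformSpace} (g : U -> V -> W -> X) : Prop :=
  cts (fun z : U * (V * W) => g (fst z) (fst (snd z)) (snd (snd z))).

Lemma cts_alt_lo {U : UniformSpace} (j : nat) (f : U -> R) : cts f -> cts (fun u => alt_lo j (f u)).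
Proof. intros Hf; unfold alt_lo; destruct (Nat.odd j); ctsx. Qed.

Lemma cts_alt_hi {U : UniformSpace} (j : nat) (f : U -> R) : cts f -> cts (fun u => alt_hi j (f u)).
Proof. intros Hf; unfold alt_hi; destruct (Nat.odd j); ctsx. Qed.

Lemma alt_lo_hi (j : nat) (p : R) : 0 <= p <= xp -> 0 <= alt_lo j p <= alt_hi j p /\ alt_hi j p <= xp.
Proof. unfold alt_lo, alt_hi; destruct (Nat.odd j); lra. Qed.

(** The parameter [u] stands for what the innermost integrand depends on besides the last variable
    and the alternating sum, such as (x, t). Carrying it through the induction gives joint
    continuity of the terms. *)
Lemma cts3_alt {U : UniformSpace} (n : nat) : forall (j : nat) (g : U -> R -> R -> R),
  cts3 g -> cts3 (fun u => alt n j (g u)).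
Proof.
  induction n as [|n IH]; intros j g Hg; [exact Hg|].
  unfold cts3; simpl.
  apply (cts_RInt (fun (z : U * (R * R)) y =>
    rr y * alt n (S j) (g (fst z)) y (snd (snd z) + sgn j * tau y))).
  - cbv beta. apply cts_mult; [ctsx|].
    apply (cts_comp3 (fun u => alt n (S j) (g u)) (fun z : U * (R * R) * R => fst (fst z)) snd
      (fun z => snd (snd (fst z)) + sgn j * tau (snd z)) (IH (S j) g Hg)); ctsx.
  - apply cts_alt_lo; ctsx.
  - apply cts_alt_hi; ctsx.
Qed.

Lemma cts2_alt (n j : nat) (g : R -> R -> R) : cts2 g -> cts2 (alt n j g).
Proof.
  intros Hg.
  apply (cts_comp3 (fun u : R => alt n j g) (fun _ => 0) fst snd); [|ctsx|ctsx|ctsx].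
  apply (cts3_alt n j (fun _ => g)). apply (cts_comp2 g); [exact Hg| |]; ctsx.
Qed.

Lemma alt_ext (n : nat) : forall (j : nat) (g g' : R -> R -> R) (p s : R),
  (forall p s, 0 <= p <= xp -> g p s = g' p s) ->
  0 <= p <= xp -> alt n j g p s = alt n j g' p s.
Proof.
  induction n as [|n IH]; intros j g g' p s E Hp; simpl; [apply E, Hp|].
  destruct (alt_lo_hi j p Hp) as [L1 L2].
  apply RInt_ext_le; [lra|]. intros y Hy; f_equal; apply IH; [exact E|lra].
Qed.

Lemma alt_scal (n : nat) : forall (j : nat) (g : R -> R -> R) (k p s : R),
  cts2 g -> k * alt n j g p s = alt n j (fun p s => k * g p s) p s.
Proof.
  induction n as [|n IH]; intros j g k p s Hg; simpl; [reflexivity|].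
  rewrite <- RInt_mult_l.
  - apply RInt_ext_R; intros y _. rewrite <- IH by exact Hg.
    ring.
  - apply cts_mult; [assumption|].
    apply (cts_comp2 (alt n (S j) g)); [apply cts2_alt, Hg| |]; ctsx.
Qed.

(** The recursion of [alt] removes the first variable; a Picard step adds a last one. Among n + 1
    variables counted from [j] the last has index [n + j], whose parity selects its range. *)
Lemma alt_snoc (n : nat) : forall (j : nat) (g : R -> R -> R) (p s : R),
  alt (S n) j g p s = alt n j (alt 1 (n + j) g) p s.
Proof.
  induction n as [|n IH]; intros j g p s; [reflexivity|].
  change (alt (S (S n)) j g p s) with
    (RInt (fun y => rr y * alt (S n) (S j) g y (s + sgn j * tau y)) (alt_lo j p) (alt_hi j p)).
  change (alt (S n) j (alt 1 (S n + j) g) p s) with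
    (RInt (fun y => rr y * alt n (S j) (alt 1 (S n + j) g) y (s + sgn j * tau y)) (alt_lo j p) (alt_hi j p)).
  apply RInt_ext_R; intros y _.
  rewrite IH. replace (n + S j)%nat with (S n + j)%nat by lia. reflexivity.
Qed.

(** The simplex does not depend on [y], so the outer integral moves through one layer at a time by
    Fubini on rectangles. *)
Lemma alt_RInt (n : nat) : forall (j : nat) (g : R -> R -> R -> R) (a b p s : R),
  cts3 g -> a <= b ->
  RInt (fun y => alt n j (g y) p s) a b = alt n j (fun p s => RInt (fun y => g y p s) a b) p s.
Proof.
  induction n as [|n IH]; intros j g a b p s Hg Hab; simpl; [reflexivity|].
  rewrite (RInt_swap_le (fun y z => rr z * alt n (S j) (g y) z (s + sgn j * tau z))).
  - apply RInt_ext_R; intros z _.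
    rewrite <- IH by assumption. apply RInt_mult_l.
    apply (cts_comp3 (fun u => alt n (S j) (g u))); [apply cts3_alt, Hg| | |]; ctsx.
  - unfold cts2; apply cts_mult; [ctsx|].
    apply (cts_comp3 (fun u => alt n (S j) (g u))); [apply cts3_alt, Hg| | |]; ctsx.
  - exact Hab.
Qed.

(** [alt_iter] passes the product of the r x_j down to [G], whereas [alt] multiplies by each factor
    on the way. Linearity of [G] in that product reconciles them, and [q] is general so that the
    induction can absorb one more factor. *)
Lemma alt_iter_alt (r : R -> R) (Hr : forall y, 0 < y < xp -> r y = rr y) (n : nat) :
  forall (j : nat) (G : R -> R -> R -> R) (g : R -> R -> R) (p s q : R),
  (forall p s q, 0 <= p <= xp -> G p s q = q * g p s) -> cts2 g -> 0 <= p <= xp ->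
  alt_iter xp tau r n j p s q G = q * alt n j g p s.
Proof.
  induction n as [|n IH]; intros j G g p s q HG Hg Hp; simpl; [apply HG, Hp|].
  assert (C : cts (fun y => rr y * alt n (S j) g y (s + sgn j * tau y))).
  { apply cts_mult; [assumption|].
    apply (cts_comp2 (alt n (S j) g)); [apply cts2_alt, Hg| |]; ctsx. }
  rewrite <- RInt_mult_l by exact C.
  fold (alt_lo j p) (alt_hi j p). destruct (alt_lo_hi j p Hp) as [L1 L2].
  apply Rint_cts; [ctsx|]. intros y Hy.
  rewrite Rmin_left, Rmax_right in Hy by lra.
  rewrite (IH (S j) G g) by (assumption || lra). rewrite Hr by lra. ring.
Qed.

(** [phi] is the wave entering at 0 as a function of time. The kernels are the innermost integrals
    of w^1 and w^2, over the last reflection point, with [p] the previous point and [s] the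
    alternating sum of travel times so far. *)
Definition left_kernel (x t p s : R) : R :=
  RInt (fun y => phi (t - 2 * (s + tau y) + tau x) * rr y) (Rmax x p) xp.
Definition right_kernel (x t p s : R) : R :=
  RInt (fun y => phi (t - 2 * (s - tau y) - tau x) * rr y) 0 (Rmin x p).

(** Scattering along the characteristic that arrives at (x, t): a left-going wave was at y >= x at
    the earlier time t - (tau y - tau x). In [right_op] the opposite sign of the exchange rate
    appears; it produces the factors (-1)^m. *)
Definition left_op (f : R -> R -> R) (x t : R) : R :=
  RInt (fun y => rr y * f y (t - tau y + tau x)) x xp.
Definition right_op (f : R -> R -> R) (x t : R) : R :=
  - RInt (fun y => rr y * f y (t - tau x + tau y)) 0 x.

Definition left_term (m : nat) (x t : R) : R := (-1) ^ m * alt (2 * m) 1 (left_kernel x t) 0 0.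
Definition right_term (m : nat) (x t : R) : R :=
  match m with
  | O => phi (t - tau x)
  | S k => (-1) ^ m * alt (S (2 * k)) 1 (right_kernel x t) 0 0
  end.

Lemma cts_left_kernel {U : UniformSpace} (x t p s : U -> R) :
  cts x -> cts t -> cts p -> cts s -> cts (fun u => left_kernel (x u) (t u) (p u) (s u)).
Proof.
  intros Hx Ht Hp Hs; unfold left_kernel.
  apply (cts_RInt (fun u y => phi (t u - 2 * (s u + tau y) + tau (x u)) * rr y)); ctsx.
Qed.

Lemma cts_right_kernel {U : UniformSpace} (x t p s : U -> R) :
  cts x -> cts t -> cts p -> cts s -> cts (fun u => right_kernel (x u) (t u) (p u) (s u)).
Proof.
  intros Hx Ht Hp Hs; unfold right_kernel.
  apply (cts_RInt (fun u y => phi (t u - 2 * (s u - tau y) - tau (x u)) * rr y)); ctsx.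
Qed.

Lemma odd_2m1 (m : nat) : Nat.odd (2 * m + 1) = true.
Proof. rewrite Nat.odd_spec. exists m; lia. Qed.

Lemma odd_2m2 (m : nat) : Nat.odd (S (2 * m) + 1) = false.
Proof.
  replace (S (2 * m) + 1)%nat with (2 * (m + 1))%nat by lia.
  rewrite Nat.odd_mul; reflexivity.
Qed.

Lemma alt1_odd (j : nat) (g : R -> R -> R) (p s : R) :
  Nat.odd j = true -> alt 1 j g p s = RInt (fun y => rr y * g y (s + tau y)) p xp.
Proof.
  intros Hj; simpl; unfold alt_lo, alt_hi, sgn; rewrite Hj.
  apply RInt_ext_R; intros y _. rewrite Rmult_1_l; reflexivity.
Qed.

Lemma alt1_even (j : nat) (g : R -> R -> R) (p s : R) :
  Nat.odd j = false -> alt 1 j g p s = RInt (fun y => rr y * g y (s - tau y)) 0 p.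
Proof.
  intros Hj; simpl; unfold alt_lo, alt_hi, sgn; rewrite Hj.
  apply RInt_ext_R; intros y _. f_equal; f_equal; ring.
Qed.

(** Once the integral of [left_op] is moved inside the simplex, only the last two variables y, z
    matter, with p fixed: one side has x <= y <= xp and 0 <= z <= min (y, p), the other 0 <= z <= p
    and max (x, z) <= y <= xp. [RInt_triangle_swap] equates them, and the phases agree
    identically. *)
Lemma left_term_rec (m : nat) (x t : R) : 0 <= x <= xp -> left_term m x t = left_op (right_term m) x t.
Proof.
  intros Hx; unfold left_op, left_term. destruct m as [|m].
  (* For m = 0 the simplex has no variable and p is the starting value 0, so [Rmax x p] is x. *)
  { simpl; unfold left_kernel. rewrite Rmax_left, Rmult_1_l by lra.
    apply RInt_ext_le; [lra|]; intros y Hy.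
    rewrite Rmult_comm; f_equal; f_equal; ring. }
  replace (2 * S m)%nat with (S (S (2 * m))) by lia. rewrite alt_snoc.
  transitivity (RInt (fun y => alt (S (2 * m)) 1
      (fun p s => (-1) ^ S m * rr y * right_kernel y (t - tau y + tau x) p s) 0 0) x xp).
  2: { apply RInt_ext_le; [lra|]; intros y Hy; simpl right_term.
       rewrite <- alt_scal by (apply cts_right_kernel; ctsx).
       change ((-1) * (-1) ^ m) with ((-1) ^ S m). simpl alt. ring. }
  rewrite alt_RInt; [|unfold cts3; apply cts_mult; [ctsx|apply cts_right_kernel; ctsx]|lra].
  rewrite alt_scal.
  2: { apply cts2_alt. apply cts_left_kernel; ctsx. }
  apply alt_ext; [|lra]. intros p s Hp.
  rewrite alt1_even by apply odd_2m2.
  set (h := fun y z => (-1) ^ S m * (rr y * (rr z * phi (t - 2 * (s - tau z + tau y) + tau x)))).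
  assert (Hh : cts2 h) by (unfold cts2, h; ctsx).
  transitivity (RInt (fun z => RInt (fun y => h y z) (Rmax x z) xp) 0 p).
  - rewrite <- RInt_mult_l.
    2: { apply cts_mult; [assumption|apply cts_left_kernel; ctsx]. }
    apply RInt_ext_le; [lra|]; intros z Hz. unfold left_kernel.
    rewrite <- Rmult_assoc, <- RInt_mult_l by ctsx.
    apply RInt_ext_R; intros y _. unfold h.
    ring.
  - rewrite <- RInt_triangle_swap by (assumption || lra).
    apply RInt_ext_le; [lra|]; intros y Hy. unfold right_kernel.
    rewrite <- RInt_mult_l by ctsx.
    apply RInt_ext_R; intros z _. unfold h.
    replace (t - tau y + tau x - 2 * (s - tau z) - tau y) with
      (t - 2 * (s - tau z + tau y) + tau x) by ring. ring.
Qed.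

(** Mirror image of [left_term_rec]: here 0 <= y <= x with max (y, p) <= z <= xp is exchanged with p
    <= z <= xp, 0 <= y <= min (z, x). The minus sign of [right_op] raises the power of -1 by one. *)
Lemma right_term_rec (m : nat) (x t : R) : 0 <= x <= xp -> right_term (S m) x t = right_op (left_term m) x t.
Proof.
  intros Hx; unfold right_op, left_term, right_term. rewrite alt_snoc.
  transitivity (RInt (fun y => alt (2 * m) 1
      (fun p s => (-1) ^ S m * rr y * left_kernel y (t - tau x + tau y) p s) 0 0) 0 x).
  2: { replace (- RInt (fun y => rr y * ((-1) ^ m * alt (2 * m) 1 (left_kernel y (t - tau x + tau y)) 0 0)) 0 x)
         with (-1 * RInt (fun y => rr y * ((-1) ^ m * alt (2 * m) 1 (left_kernel y (t - tau x + tau y)) 0 0)) 0 x) by ring.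
       rewrite <- RInt_mult_l.
       - apply RInt_ext_le; [lra|]; intros y Hy.
         rewrite <- alt_scal by (apply cts_left_kernel; ctsx). simpl pow. ring.
       - apply cts_mult; [assumption|]; apply cts_mult; [ctsx|].
         apply (cts_comp3 (fun y => alt (2 * m) 1 (left_kernel y (t - tau x + tau y)))); ctsx.
         apply (cts3_alt (2 * m) 1 (fun y => left_kernel y (t - tau x + tau y))).
         unfold cts3; apply cts_left_kernel; ctsx. }
  rewrite alt_RInt; [|unfold cts3; apply cts_mult; [ctsx|apply cts_left_kernel; ctsx]|lra].
  rewrite alt_scal.
  2: { apply cts2_alt. apply cts_right_kernel; ctsx. }
  apply alt_ext; [|lra]. intros p s Hp.
  rewrite alt1_odd by apply odd_2m1.
  set (h := fun z y => (-1) ^ S m * (rr y * (rr z * phi (t - 2 * (s + tau z - tau y) - tau x)))).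
  assert (Hh : cts2 h) by (unfold cts2, h; ctsx).
  transitivity (RInt (fun z => RInt (h z) 0 (Rmin z x)) p xp).
  - rewrite <- RInt_mult_l.
    2: { apply cts_mult; [assumption|apply cts_right_kernel; ctsx]. }
    apply RInt_ext_le; [lra|]; intros z Hz. unfold right_kernel.
    rewrite <- Rmult_assoc, <- RInt_mult_l by ctsx.
    rewrite (Rmin_comm z x).
    apply RInt_ext_R; intros y _. unfold h.
    ring.
  - rewrite RInt_triangle_swap by (assumption || lra).
    apply RInt_ext_le; [lra|]; intros y Hy. unfold left_kernel.
    rewrite <- RInt_mult_l by ctsx. rewrite (Rmax_comm y p).
    apply RInt_ext_R; intros z _. unfold h.
    replace (t - tau x + tau y - 2 * (s + tau z) + tau y) with
      (t - 2 * (s + tau z - tau y) - tau x) by ring. ring.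
Qed.

Variable c : R -> R.
Hypothesis cts_c : cts c.
Hypothesis c_pos : forall y, 0 < c y.
Hypothesis tau_derive : forall y, is_derive tau y (/ c y).

Lemma tau_le (x y : R) : x <= y -> tau x <= tau y.
Proof.
  intros [H| ->]; [left|right; reflexivity].
  apply (increasing_of_derive tau (fun y => / c y)); try assumption.
  intros z; apply Rinv_0_lt_compat, c_pos.
Qed.

Lemma left_op_minus (f g k : R -> R -> R) (x t : R) :
  cts2 f -> cts2 g -> (forall y s, 0 <= y <= xp -> k y s = f y s - g y s) ->
  0 <= x <= xp -> left_op k x t = left_op f x t - left_op g x t.
Proof.
  intros Hf Hg E Hx. unfold left_op.
  rewrite <- (RInt_minus (V := R_CompleteNormedModule)).
  - apply RInt_ext_le; [lra|]; intros y Hy. rewrite E by lra. apply Rmult_minus_distr_l.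
  - apply cts_ex_RInt; ctsx.
  - apply cts_ex_RInt; ctsx.
Qed.

Lemma right_op_minus (f g k : R -> R -> R) (x t : R) :
  cts2 f -> cts2 g -> (forall y s, 0 <= y <= xp -> k y s = f y s - g y s) ->
  0 <= x <= xp -> right_op k x t = right_op f x t - right_op g x t.
Proof.
  intros Hf Hg E Hx. unfold right_op.
  replace (RInt (fun y => rr y * k y (t - tau x + tau y)) 0 x) with
    (RInt (fun y => rr y * f y (t - tau x + tau y)) 0 x -
     RInt (fun y => rr y * g y (t - tau x + tau y)) 0 x); [ring|].
  symmetry. rewrite <- (RInt_minus (V := R_CompleteNormedModule)).
  - apply RInt_ext_le; [lra|]; intros y Hy. rewrite E by lra. apply Rmult_minus_distr_l.
  - apply cts_ex_RInt; ctsx.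
  - apply cts_ex_RInt; ctsx.
Qed.

Lemma cts2_left_term (m : nat) : cts2 (left_term m).
Proof.
  unfold cts2, left_term; apply cts_mult; [ctsx|].
  apply (cts_comp3 (fun z : R * R => alt (2 * m) 1 (left_kernel (fst z) (snd z)))); ctsx.
  apply (cts3_alt (2 * m) 1
    (fun z : R * R => left_kernel (fst z) (snd z))).
  unfold cts3; apply cts_left_kernel; ctsx.
Qed.

Lemma cts2_right_term (m : nat) : cts2 (right_term m).
Proof.
  unfold cts2; destruct m as [|m]; unfold right_term; [ctsx|].
  apply cts_mult; [ctsx|].
  apply (cts_comp3 (fun z : R * R => alt (S (2 * m)) 1 (right_kernel (fst z) (snd z)))); ctsx.
  apply (cts3_alt (S (2 * m)) 1
    (fun z : R * R => right_kernel (fst z) (snd z))).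
  unfold cts3; apply cts_right_kernel; ctsx.
Qed.

(** * Convergence of the Picard iterates *)

(** Times are bounded only from above because characteristics traced backwards may reach negative
    times. *)
Definition exp_bounded (lam T M : R) (f : R -> R -> R) : Prop :=
  forall x t, 0 <= x <= xp -> t <= T -> Rabs (f x t) <= M * exp (lam * t).

Section Contraction.

Variables (Q lam : R).
Hypothesis Q_bound : forall y, 0 <= y <= xp -> Rabs (rr y) * c y <= Q.
Hypothesis Q_lam : 2 * Q <= lam.
Hypothesis lam_pos : 0 < lam.

(* [s] is the time along a characteristic, [E0 = 1, -1] its direction; since
   [|rr| <= Q / c = Q |s'|], the majorant of [f] is an exact derivative. *)
Lemma contraction_estimate (E0 M a b : R) (f s ds : R -> R) :
  0 <= a <= b -> b <= xp -> 0 <= M -> cts f -> cts s -> cts ds ->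
  (forall y, is_derive s y (ds y)) ->
  (forall y, ds y = E0 * / c y) -> E0 * E0 = 1 ->
  (forall y, a <= y <= b -> Rabs (f y) <= Rabs (rr y) * (M * exp (lam * s y))) ->
  Rabs (RInt f a b) <= M * (1 / 2) * Rabs (exp (lam * s b) - exp (lam * s a)).
Proof.
  intros Hab Hb HM Hf Hs Hds D Eds HE B.
  assert (HQ : 0 <= Q).
  { eapply Rle_trans; [|apply (Q_bound 0); lra].
    apply Rmult_le_pos; [apply Rabs_pos|left; apply c_pos]. }
  assert (Cexp : cts (fun y => exp (lam * s y))).
  { apply (cts_comp exp); [|ctsx].
    apply cts_of_continuity, derivable_continuous, derivable_exp. }
  eapply Rle_trans.
  - apply (abs_RInt_le_derive f (fun y => Q * M * E0 * / lam * exp (lam * s y))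
      (fun y => Q * M * / c y * exp (lam * s y)) a b); [lra|exact Hf| | |].
    + apply cts_mult; [apply cts_mult; [ctsx|]|exact Cexp].
      apply cts_inv; [intros u; apply Rgt_not_eq, c_pos|exact cts_c].
    + intros y. auto_derive; [eexists; apply D|].
      replace (Derive (fun x : R => s x) y) with (ds y) by (symmetry; apply is_derive_unique, D).
      rewrite Eds.
      transitivity (Q * M * (E0 * E0) * (/ c y) * exp (lam * s y)); [|rewrite HE; ring].
      field; split; [apply Rgt_not_eq, c_pos|lra].
    + intros y Hy. eapply Rle_trans; [apply B, Hy|].
      assert (Z : Rabs (rr y) <= Q * / c y).
      { apply Rmult_le_reg_r with (c y); [apply c_pos|].
        rewrite Rmult_assoc, Rinv_l, Rmult_1_r by (apply Rgt_not_eq, c_pos).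
        apply Q_bound; lra. }
      assert (W : 0 <= M * exp (lam * s y)) by (apply Rmult_le_pos; [exact HM|left; apply exp_pos]).
      nra.
  - set (X := exp (lam * s b)); set (Y := exp (lam * s a)).
    replace (Q * M * E0 * / lam * X - Q * M * E0 * / lam * Y) with
      (M * (Q / lam) * (E0 * (X - Y))) by (field; lra).
    assert (HA : E0 * (X - Y) <= Rabs (X - Y)).
    { assert (E0 = 1 \/ E0 = -1) as [-> | ->]
        by (assert (H : (E0 - 1) * (E0 + 1) = 0) by lra; apply Rmult_integral in H; lra);
      unfold Rabs; destruct (Rcase_abs _); lra. }
    assert (HQl : 0 <= Q / lam <= 1 / 2).
    { split; [apply Rmult_le_pos; [exact HQ|left; apply Rinv_0_lt_compat, lam_pos]|].
      apply Rmult_le_reg_r with lam; [exact lam_pos|].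
      unfold Rdiv; rewrite Rmult_assoc, Rinv_l by lra. lra. }
    assert (HP := Rabs_pos (X - Y)).
    apply Rle_trans with (M * (Q / lam) * Rabs (X - Y)).
    + apply Rmult_le_compat_l; [apply Rmult_le_pos; lra|exact HA].
    + apply Rmult_le_compat_r; [exact HP|]. apply Rmult_le_compat_l; lra.
Qed.

Lemma exp_le_mono (a b : R) : a <= b -> exp (lam * a) <= exp (lam * b).
Proof.
  intros [H| ->]; [left; apply exp_increasing; nra|right; reflexivity].
Qed.

(** Time runs backwards from t along the path, so it stays below T, and the difference of
    exponentials in [contraction_estimate] is at most exp (lam t). *)
Lemma left_op_contraction (T M : R) (f : R -> R -> R) :
  0 <= M -> cts2 f -> exp_bounded lam T M f -> exp_bounded lam T (M * (1 / 2)) (left_op f).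
Proof.
  intros HM Hf B x t Hx Ht. unfold left_op.
  eapply Rle_trans.
  - apply (contraction_estimate (-1) M x xp _ (fun y => t - tau y + tau x) (fun y => -1 * / c y));
      try lra; try ctsx.
    + apply cts_inv; [intros u; apply Rgt_not_eq, c_pos|exact cts_c].
    + intros y. auto_derive; [eexists; apply tau_derive|].
      replace (Derive (fun x : R => tau x) y) with (/ c y) by (symmetry; apply is_derive_unique, tau_derive).
      ring.
    + intros y; reflexivity.
    + intros y Hy. rewrite Rabs_mult. apply Rmult_le_compat_l; [apply Rabs_pos|].
      apply B; [lra|]. assert (A := tau_le x y ltac:(lra)). lra.
  - apply Rmult_le_compat_l; [lra|].
    replace (t - tau x + tau x) with t by ring.
    assert (A := exp_le_mono (t - tau xp + tau x) t ltac:(assert (Z := tau_le x xp ltac:(lra)); lra)).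
    assert (P := exp_pos (lam * (t - tau xp + tau x))).
    unfold Rabs; destruct (Rcase_abs _); lra.
Qed.

Lemma right_op_contraction (T M : R) (f : R -> R -> R) :
  0 <= M -> cts2 f -> exp_bounded lam T M f -> exp_bounded lam T (M * (1 / 2)) (right_op f).
Proof.
  intros HM Hf B x t Hx Ht. unfold right_op. rewrite Rabs_Ropp.
  eapply Rle_trans.
  - apply (contraction_estimate 1 M 0 x _ (fun y => t - tau x + tau y) (fun y => 1 * / c y));
      try lra; try ctsx.
    + apply cts_inv; [intros u; apply Rgt_not_eq, c_pos|exact cts_c].
    + intros y. auto_derive; [eexists; apply tau_derive|].
      replace (Derive (fun x : R => tau x) y) with (/ c y) by (symmetry; apply is_derive_unique, tau_derive).
      ring.
    + intros y; reflexivity.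
    + intros y Hy. rewrite Rabs_mult. apply Rmult_le_compat_l; [apply Rabs_pos|].
      apply B; [lra|]. assert (A := tau_le y x ltac:(lra)). lra.
  - apply Rmult_le_compat_l; [lra|].
    replace (t - tau x + tau x) with t by ring.
    assert (A := exp_le_mono (t - tau x + tau 0) t ltac:(assert (Z := tau_le 0 x ltac:(lra)); lra)).
    assert (P := exp_pos (lam * (t - tau x + tau 0))).
    unfold Rabs; destruct (Rcase_abs _); lra.
Qed.

End Contraction.

(** Recursive rather than through [sum_f_R0], which always has at least one term: here m = 0 leaves
    [f] itself. *)
Fixpoint remainder (f : R -> R -> R) (v : nat -> R -> R -> R) (m : nat) (x t : R) : R :=
  match m with
  | O => f x t
  | S k => remainder f v k x t - v k x t
  end.

Lemma remainder_sum (f : R -> R -> R) (v : nat -> R -> R -> R) (n : nat) (x t : R) :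
  sum_f_R0 (fun m => v m x t) n = f x t - remainder f v (S n) x t.
Proof.
  induction n as [|n IH]; [simpl; ring|].
  rewrite tech5, IH. simpl; ring.
Qed.

Lemma cts2_remainder (f : R -> R -> R) (v : nat -> R -> R -> R) (m : nat) :
  cts2 f -> (forall k, cts2 (v k)) -> cts2 (remainder f v m).
Proof.
  intros Hf Hv; induction m as [|m IH]; [exact Hf|].
  apply (cts_minus (fun z : R * R => remainder f v m (fst z) (snd z))); [exact IH|apply Hv].
Qed.

Lemma infinite_sum_of_remainder (f : R -> R -> R) (v : nat -> R -> R -> R) (M x t : R) :
  (forall m, Rabs (remainder f v m x t) <= M * (1 / 2) ^ m) ->
  infinite_sum (fun m => v m x t) (f x t).
Proof.
  intros B eps Heps.
  assert (M0 : 0 <= M).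
  { assert (Z := B O). simpl in Z. assert (Y := Rabs_pos (f x t)). lra. }
  destruct (pow_lt_1_zero (1 / 2) ltac:(rewrite Rabs_right; lra) (eps / (M + 1))) as [N HN].
  { apply Rdiv_lt_0_compat; lra. }
  exists N; intros n Hn. unfold Rdist. rewrite (remainder_sum f).
  replace (f x t - remainder f v (S n) x t - f x t) with (- remainder f v (S n) x t) by ring.
  rewrite Rabs_Ropp. eapply Rle_lt_trans; [apply B|].
  assert (Z := HN (S n) ltac:(lia)).
  assert (P : 0 < (1 / 2) ^ S n) by (apply pow_lt; lra).
  rewrite Rabs_right in Z by lra.
  apply Rle_lt_trans with ((M + 1) * (1 / 2) ^ S n); [nra|].
  apply Rlt_le_trans with ((M + 1) * (eps / (M + 1))); [apply Rmult_lt_compat_l; lra|].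
  right; field; lra.
Qed.

Variables (f_right f_left : R -> R -> R).
Hypothesis cts_f_right : cts2 f_right.
Hypothesis cts_f_left : cts2 f_left.
Hypothesis f_right_zero : forall x t, 0 <= x <= xp -> t <= 0 -> f_right x t = 0.
Hypothesis f_right_eq : forall x t, 0 <= x <= xp -> f_right x t = phi (t - tau x) + right_op f_left x t.
Hypothesis f_left_eq : forall x t, 0 <= x <= xp -> f_left x t = left_op f_right x t.

Lemma remainder_left (m : nat) : forall x t, 0 <= x <= xp ->
  remainder f_left left_term m x t = left_op (remainder f_right right_term m) x t.
Proof.
  induction m as [|m IH]; intros x t Hx; [apply f_left_eq, Hx|].
  cbn [remainder]. rewrite IH, left_term_rec by assumption.
  symmetry; apply (left_op_minus (remainder f_right right_term m) (right_term m)); [|apply cts2_right_term|reflexivity|exact Hx].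
  apply cts2_remainder; [exact cts_f_right|exact cts2_right_term].
Qed.

(** Subtracting term 0 removes the entry term; from there on the remainders solve the homogeneous
    system. *)
Lemma remainder_right (m : nat) : forall x t, 0 <= x <= xp ->
  remainder f_right right_term (S m) x t = right_op (remainder f_left left_term m) x t.
Proof.
  induction m as [|m IH]; intros x t Hx.
  { change (f_right x t - phi (t - tau x) = right_op f_left x t). rewrite f_right_eq by exact Hx. ring. }
  change (remainder f_right right_term (S m) x t - right_term (S m) x t = right_op (remainder f_left left_term (S m)) x t).
  rewrite IH, right_term_rec by assumption.
  symmetry; apply (right_op_minus (remainder f_left left_term m) (left_term m)); [|apply cts2_left_term|reflexivity|exact Hx].
  apply cts2_remainder; [exact cts_f_left|apply cts2_left_term].
Qed.

(** Compactness bounds f for 0 <= t <= T, where the weight is at least 1, and f vanishes at earlier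
    times. *)
Lemma exp_bounded_init (lam T : R) (f : R -> R -> R) :
  0 < lam -> cts2 f -> (forall x t, 0 <= x <= xp -> t <= 0 -> f x t = 0) ->
  exists M, 0 <= M /\ exp_bounded lam T M f.
Proof.
  intros Hl Hf Hz. destruct (cts_bounded2 f 0 xp 0 T Hf) as [M HM].
  exists (Rabs M); split; [apply Rabs_pos|]. intros x t Hx Ht.
  assert (P := exp_pos (lam * t)). assert (A := Rabs_pos M).
  destruct (Rle_dec t 0) as [H|H].
  - rewrite Hz, Rabs_R0 by assumption. apply Rmult_le_pos; lra.
  - assert (E : 1 <= exp (lam * t)).
    { rewrite <- exp_0. left; apply exp_increasing; nra. }
    assert (Z := HM x t Hx ltac:(lra)). assert (W := Rle_abs M). nra.
Qed.

Theorem scattering_series (x t : R) :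
  0 <= x <= xp ->
  infinite_sum (fun m => left_term m x t) (f_left x t) /\ infinite_sum (fun m => right_term m x t) (f_right x t).
Proof.
  intros Hx.
  (* A one-variable bound, obtained with a dummy second variable in [[0, 0]]. *)
  destruct (cts_bounded2 (fun y _ => Rabs (rr y) * c y) 0 xp 0 0) as [Q HQ].
  { apply cts_mult; [apply cts_abs, (cts_comp rr); ctsx|apply (cts_comp c); ctsx]. }
  (* The summand 1 keeps [lam] positive even when r vanishes identically. *)
  set (lam := 2 * Rabs Q + 1). assert (HAQ := Rabs_pos Q).
  assert (Hlam : 0 < lam) by (unfold lam; lra).
  assert (HQ' : forall y, 0 <= y <= xp -> Rabs (rr y) * c y <= Q).
  { intros y Hy. eapply Rle_trans; [apply Rle_abs|apply (HQ y 0); lra]. }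
  assert (HQl : 2 * Q <= lam) by (unfold lam; assert (Z := Rle_abs Q); lra).
  destruct (exp_bounded_init lam t f_right Hlam cts_f_right f_right_zero) as [M1 [P1 B1]].
  assert (R2 : forall m, cts2 (remainder f_right right_term m)) by
    (intros m; apply cts2_remainder; [exact cts_f_right|apply cts2_right_term]).
  assert (R1 : forall m, cts2 (remainder f_left left_term m)) by
    (intros m; apply cts2_remainder; [exact cts_f_left|apply cts2_left_term]).
  assert (PW : forall m, 0 <= M1 * (1 / 2) ^ m).
  { intros m; apply Rmult_le_pos; [exact P1|left; apply pow_lt; lra]. }
  (* The gain of [left_op] is given away here, so that both families of remainders share one bound;
     the factor 1/2 per index comes from [right_op] alone. *)
  assert (BS : forall m, exp_bounded lam t (M1 * (1 / 2) ^ m) (remainder f_right right_term m) ->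
      exp_bounded lam t (M1 * (1 / 2) ^ m) (remainder f_left left_term m)).
  { intros m Hm y s Hy Hs. rewrite remainder_left by exact Hy.
    eapply Rle_trans; [apply (left_op_contraction Q lam HQ' HQl Hlam t _ _ (PW m) (R2 m) Hm y s Hy Hs)|].
    apply Rmult_le_compat_r; [left; apply exp_pos|]. assert (Z := PW m); lra. }
  assert (BA : forall m, exp_bounded lam t (M1 * (1 / 2) ^ m) (remainder f_right right_term m)).
  { induction m as [|m IH].
    - simpl pow; rewrite Rmult_1_r. exact B1.
    - intros y s Hy Hs. rewrite remainder_right by exact Hy.
      replace (M1 * (1 / 2) ^ S m) with (M1 * (1 / 2) ^ m * (1 / 2)) by (simpl; ring).
      apply (right_op_contraction Q lam HQ' HQl Hlam t _ _ (PW m) (R1 m) (BS m IH) y s Hy Hs). }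
  split; apply (infinite_sum_of_remainder _ _ (M1 * exp (lam * t)) x t); intros m.
  - eapply Rle_trans; [apply (BS m (BA m) x t Hx ltac:(lra))|right; ring].
  - eapply Rle_trans; [apply (BA m x t Hx ltac:(lra))|right; ring].
Qed.

End Alternating.

(** * Series, and continuous functions constant on an interval *)

Lemma infinite_sum_ext (f g : nat -> R) (l : R) :
  (forall m, f m = g m) -> infinite_sum f l -> infinite_sum g l.
Proof.
  intros E H eps He. destruct (H eps He) as [N HN]; exists N; intros n Hn.
  rewrite <- (sum_eq f g) by (intros; apply E). apply HN, Hn.
Qed.

Lemma infinite_sum_scal (f : nat -> R) (k l : R) :
  infinite_sum f l -> infinite_sum (fun m => k * f m) (k * l).
Proof.
  rewrite <- !is_series_Reals. apply (is_series_scal (K := R_AbsRing) (V := R_NormedModule) k f l).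
Qed.

Lemma infinite_sum_singleton (f : nat -> R) :
  (forall m, f (S m) = 0) -> infinite_sum f (f O).
Proof.
  intros E eps He; exists O; intros n _.
  replace (sum_f_R0 f n) with (f O); [unfold Rdist; rewrite Rminus_diag, Rabs_R0; exact He|].
  induction n as [|n IH]; [reflexivity|]. rewrite tech5, E, <- IH; ring.
Qed.

(* The exceptional point is where a characteristic meets the line [t = 0]. *)
Lemma const_except (f : R -> R) (a b c : R) :
  a <= b -> cts f -> (forall y, a < y < b -> y <> c -> is_derive f y 0) -> f a = f b.
Proof.
  intros Hab Hf D.
  assert (P : forall x y, a <= x <= y -> y <= b -> ~ x < c < y -> f x = f y).
  { intros x y H1 H2 Hc. destruct (MVT_gen f x y (fun _ => 0)) as [z [_ Hz]]; [| |lra].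
    - rewrite Rmin_left, Rmax_right by lra. intros z Hz. apply D; [lra|].
      intros ->; apply Hc; lra.
    - intros z _; apply cts_continuity, Hf. }
  destruct (Rlt_dec a c); [destruct (Rlt_dec c b)|].
  - transitivity (f c); apply P; lra.
  - apply P; lra.
  - apply P; lra.
Qed.

(** The coefficients are prescribed on open half-lines only; this and its mirror image carry their
    constant values to 0 and [xp]. *)
Lemma cts_eq_left_end (f : R -> R) (a b k : R) :
  cts f -> a < b -> (forall x, a < x < b -> f x = k) -> f b = k.
Proof.
  intros Hf Hab E.
  destruct (Req_dec (f b) k) as [|N]; [assumption|exfalso].
  assert (He : 0 < Rabs (f b - k)) by (apply Rabs_pos_lt; lra).
  destruct (proj1 (filterlim_locally _ _) (Hf b) (mkposreal _ He)) as [d Hd].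
  set (x := b - Rmin (d / 2) ((b - a) / 2)).
  assert (M1 := Rmin_l (d / 2) ((b - a) / 2)). assert (M2 := Rmin_r (d / 2) ((b - a) / 2)).
  assert (M3 : 0 < Rmin (d / 2) ((b - a) / 2)) by (assert (Z := cond_pos d); apply Rmin_pos; lra).
  assert (B : ball b d x).
  { change (Rabs (x - b) < d). unfold x. rewrite Rabs_left by lra.
    assert (Z := cond_pos d); lra. }
  specialize (Hd x B). change (Rabs (f x - f b) < Rabs (f b - k)) in Hd.
  rewrite (E x) in Hd by (unfold x; lra). rewrite Rabs_minus_sym in Hd. lra.
Qed.

Lemma cts_eq_right_end (f : R -> R) (a b k : R) :
  cts f -> a < b -> (forall x, a < x < b -> f x = k) -> f a = k.
Proof.
  intros Hf Hab E. rewrite <- (Ropp_involutive a).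
  apply (cts_eq_left_end (fun x => f (- x)) (- b) (- a)); [|lra|intros x Hx; apply E; lra].
  apply (cts_comp f); [exact Hf|apply cts_opp, cts_id].
Qed.

(** * Riemann invariants along characteristics *)

Definition clamp (a b x : R) : R := Rmax a (Rmin x b).

Lemma clamp_id (a b x : R) : a <= x <= b -> clamp a b x = x.
Proof. intros H; unfold clamp; rewrite Rmin_left, Rmax_right by lra; reflexivity. Qed.

Lemma clamp_range (a b x : R) : a <= b -> a <= clamp a b x <= b.
Proof. intros H; unfold clamp, Rmax, Rmin; destruct (Rle_dec x b), (Rle_dec a _); lra. Qed.

Lemma clamp_contract (a b x y : R) : Rabs (clamp a b x - clamp a b y) <= Rabs (x - y).
Proof.
  unfold clamp, Rmax, Rmin, Rabs.
  destruct (Rle_dec x b), (Rle_dec y b); repeat destruct (Rle_dec a _);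
    repeat destruct (Rcase_abs _); lra.
Qed.

(** Composition with the 1-Lipschitz retraction [clamp] turns continuity relative to the interval
    into continuity on the line. *)
Lemma cts_cont_on (f : R -> R) (a b : R) :
  a <= b -> cont_on f a b -> cts (fun x => f (clamp a b x)).
Proof.
  intros Hab Hf x. apply filterlim_locally; intros eps.
  destruct (Hf (clamp a b x) (clamp_range a b x Hab) eps (cond_pos eps)) as [d [Hd H]].
  exists (mkposreal d Hd); intros y Hy.
  apply (H (clamp a b y)). split; [apply clamp_range, Hab|].
  eapply Rle_lt_trans; [apply clamp_contract|exact Hy].
Qed.

Lemma deriv_on_interior (f df : R -> R) (a b x : R) :
  deriv_on f df a b -> a < x < b -> is_derive f x (df x).
Proof.
  intros Hf Hx. apply is_derive_Reals. intros eps He.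
  destruct (Hf x ltac:(lra) eps He) as [d [Hd H]].
  assert (P : 0 < Rmin d (Rmin (x - a) (b - x))) by (repeat apply Rmin_pos; lra).
  exists (mkposreal _ P); simpl; intros h Hh Hl.
  assert (M1 := Rmin_l d (Rmin (x - a) (b - x))). assert (M2 := Rmin_r d (Rmin (x - a) (b - x))).
  assert (M3 := Rmin_l (x - a) (b - x)). assert (M4 := Rmin_r (x - a) (b - x)).
  assert (Z := H (x + h)). simpl in Z; unfold Rdist in Z.
  replace (x + h - x) with h in Z by ring. apply Z.
  assert (Rabs h < x - a /\ Rabs h < b - x) as [A1 A2] by lra.
  apply Rabs_def2 in A1; apply Rabs_def2 in A2.
  split; [split; [lra|]|lra]. intros E; apply Hh; lra.
Qed.

(** One partial derivative continuous near the point and the other existing there make [f]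
    differentiable in both variables, and the chain rule applies. *)
Lemma is_derive_along (f fx ft : R -> R -> R) (s : R -> R) (y ds : R) :
  (forall x t, 0 < t -> derivable_pt_lim (fun s => f x s) t (ft x t)) ->
  (forall x t, 0 < t -> derivable_pt_lim (fun y => f y t) x (fx x t)) ->
  (forall x t, 0 < t -> cont2_at (fun _ s => 0 < s) fx x t) ->
  0 < s y -> is_derive s y ds ->
  is_derive (fun z => f z (s z)) y (fx y (s y) + ft y (s y) * ds).
Proof.
  intros Ht Hx Hc Hs Ds.
  assert (L : locally (y, s y) (fun z : R * R => 0 < snd z)).
  { exists (mkposreal _ Hs); intros [a b] [_ Hb]. simpl in *.
    change (Rabs (b - s y) < s y) in Hb. apply Rabs_def2 in Hb. lra. }
  assert (F : filterdiff (fun z : R * R => f (fst z) (snd z)) (locally (y, s y))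
    (fun z : R * R => plus (scal (fst z) (fx y (s y))) (scal (snd z) (ft y (s y))))).
  { apply (is_derive_filterdiff f y (s y) fx (ft y (s y))).
    - revert L; apply filter_imp; intros [a b] H; apply is_derive_Reals, Hx, H.
    - apply is_derive_Reals, Ht, Hs.
    - apply filterlim_locally; intros eps.
      destruct (Hc y (s y) Hs eps (cond_pos eps)) as [d [Hd H]].
      assert (L2 : locally (y, s y) (fun z : R * R => ball (y, s y) d z))
        by (exists (mkposreal d Hd); intros z Hz; exact Hz).
      generalize (filter_and _ _ L L2); apply filter_imp.
      intros [a b] [H1 [H2 H3]]. apply H; [exact H1|exact H2|exact H3]. }
  assert (G := filterdiff_comp'_2 (fun z : R => z) s f y (fun z => z) (fun z => scal z ds)
    (fun a b => plus (scal a (fx y (s y))) (scal b (ft y (s y)))) (filterdiff_id _) Ds F).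
  refine (filterdiff_ext_lin _ _ _ G _).
  intros z; unfold scal, plus; simpl; unfold mult; simpl. ring.
Qed.

Section Characteristics.

Variables (xp : R) (K rho : R -> R) (Km rm Kp rp : R) (dK drho dZ : R -> R).
Variables (p0 : R -> R) (p u pt px ut ux : R -> R -> R).
Hypothesis xp_pos : 0 < xp.
Hypothesis K_pos : forall x, 0 < K x.
Hypothesis rho_pos : forall x, 0 < rho x.
Hypothesis K_cont : continuity K.
Hypothesis rho_cont : continuity rho.
Hypothesis left_const : forall x, x < 0 -> K x = Km /\ rho x = rm.
Hypothesis right_const : forall x, xp < x -> K x = Kp /\ rho x = rp.
Hypothesis K_deriv : deriv_on K dK 0 xp.
Hypothesis dK_cont : cont_on dK 0 xp.
Hypothesis rho_deriv : deriv_on rho drho 0 xp.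
Hypothesis drho_cont : cont_on drho 0 xp.
Hypothesis Z_deriv : deriv_on (Zf K rho) dZ 0 xp.
Hypothesis p0_cts : cts p0.
Hypothesis p0_zero : forall xi, 0 <= xi -> p0 xi = 0.
Hypothesis p_t : forall x t, 0 < t -> derivable_pt_lim (fun s => p x s) t (pt x t).
Hypothesis p_x : forall x t, 0 < t -> derivable_pt_lim (fun y => p y t) x (px x t).
Hypothesis u_t : forall x t, 0 < t -> derivable_pt_lim (fun s => u x s) t (ut x t).
Hypothesis u_x : forall x t, 0 < t -> derivable_pt_lim (fun y => u y t) x (ux x t).
Hypothesis px_cont : forall x t, 0 < t -> cont2_at (fun _ s => 0 < s) px x t.
Hypothesis ux_cont : forall x t, 0 < t -> cont2_at (fun _ s => 0 < s) ux x t.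
Hypothesis p_cont : forall x t, 0 <= t -> cont2_at (fun _ s => 0 <= s) p x t.
Hypothesis u_cont : forall x t, 0 <= t -> cont2_at (fun _ s => 0 <= s) u x t.
Hypothesis eq_p : forall x t, 0 < t -> pt x t + K x * ux x t = 0.
Hypothesis eq_u : forall x t, 0 < t -> ut x t + / rho x * px x t = 0.
Hypothesis init_p : forall x, p x 0 = p0 x.
Hypothesis init_u : forall x, u x 0 = p0 x / Zm Km rm.

Local Notation Z := (Zf K rho).
Local Notation c := (cf K rho).
Local Notation c_m := (cm Km rm).
Local Notation Z_m := (Zm Km rm).

Lemma Z_pos (x : R) : 0 < Z x.
Proof. apply sqrt_lt_R0, Rmult_lt_0_compat; [apply K_pos|apply rho_pos]. Qed.

Lemma c_pos (x : R) : 0 < c x.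
Proof. apply sqrt_lt_R0, Rdiv_lt_0_compat; [apply K_pos|apply rho_pos]. Qed.

Lemma cts_K : cts K. Proof. apply cts_of_continuity, K_cont. Qed.
Lemma cts_rho : cts rho. Proof. apply cts_of_continuity, rho_cont. Qed.

Lemma cts_Z : cts Z.
Proof. apply cts_sqrt, cts_mult; [apply cts_K|apply cts_rho]. Qed.

Lemma cts_inv_rho : cts (fun x => / rho x).
Proof. apply cts_inv; [intros x; apply Rgt_not_eq, rho_pos|apply cts_rho]. Qed.

Lemma cts_c : cts c.
Proof. apply cts_sqrt, cts_mult; [apply cts_K|apply cts_inv_rho]. Qed.

(** With K = Z c and, below, 1 / rho = c / Z, the system reads p_t / c = - Z u_x and u_t / c = - p_x
    / Z, the form used in [riemann_along]. *)
Lemma Z_c (x : R) : Z x * c x = K x.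
Proof.
  unfold Zf, cf. assert (HK := K_pos x). assert (Hr := rho_pos x).
  rewrite <- sqrt_mult.
  - replace (K x * rho x * (K x / rho x)) with (K x * K x) by (field; lra).
    apply sqrt_square; lra.
  - apply Rmult_le_pos; lra.
  - left; apply Rdiv_lt_0_compat; lra.
Qed.

Lemma c_div_Z (x : R) : c x / Z x = / rho x.
Proof.
  assert (HK := K_pos x). assert (Hr := rho_pos x). assert (HZ := Z_pos x).
  assert (E := Z_c x). assert (E2 : Z x * Z x = K x * rho x).
  { apply sqrt_sqrt, Rmult_le_pos; lra. }
  apply Rmult_eq_reg_r with (Z x * Z x * rho x).
  - transitivity (Z x * c x * rho x); [field; lra|].
    rewrite E. transitivity (Z x * Z x); [rewrite E2; ring|field; lra].
  - rewrite E2. apply Rgt_not_eq. repeat apply Rmult_lt_0_compat; assumption.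
Qed.

Lemma K_left : K 0 = Km /\ rho 0 = rm.
Proof.
  split; [apply (cts_eq_left_end K (-1)); [apply cts_K|lra|]|
          apply (cts_eq_left_end rho (-1)); [apply cts_rho|lra|]];
  intros x Hx; apply left_const; lra.
Qed.

Lemma c_left (x : R) : x <= 0 -> c x = c_m.
Proof.
  intros [H| ->]; unfold cf, cm.
  - destruct (left_const x H) as [-> ->]; reflexivity.
  - destruct K_left as [-> ->]; reflexivity.
Qed.

Lemma Z_left (x : R) : x <= 0 -> Z x = Z_m.
Proof.
  intros [H| ->]; unfold Zf, Zm.
  - destruct (left_const x H) as [-> ->]; reflexivity.
  - destruct K_left as [-> ->]; reflexivity.
Qed.

(** [cm] is only the formula sqrt (K / rho), so [cm Kp rp] is c_+. *)
Lemma c_right (x : R) : xp <= x -> c x = cm Kp rp.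
Proof.
  assert (E : forall y, xp < y -> c y = cm Kp rp).
  { intros y Hy; unfold cf, cm. destruct (right_const y Hy) as [-> ->]; reflexivity. }
  intros [H| <-]; [apply E, H|].
  apply (cts_eq_right_end c xp (xp + 1)); [apply cts_c|lra|intros y Hy; apply E; lra].
Qed.

(** Meaningful on the whole line, and negative to the left of 0, so t = s0 + sigma * travel x
    describes characteristics outside [[0, xp]] as well. *)
Definition travel (x : R) : R := RInt (fun s => / c s) 0 x.

Lemma cts_inv_c : cts (fun s => / c s).
Proof. apply cts_inv; [intros x; apply Rgt_not_eq, c_pos|apply cts_c]. Qed.

Lemma travel_derive (y : R) : is_derive travel y (/ c y).
Proof. apply (is_derive_RInt_cts (fun s => / c s)), cts_inv_c. Qed.

Lemma cts_travel : cts travel.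
Proof. intros y; apply (ex_derive_continuous (V := R_NormedModule)); eexists; apply travel_derive. Qed.

Lemma travel_0 : travel 0 = 0.
Proof. apply (RInt_point (V := R_CompleteNormedModule)). Qed.

Lemma travel_lt (x y : R) : x < y -> travel x < travel y.
Proof.
  apply (increasing_of_derive travel (fun y => / c y)); [apply travel_derive|].
  intros z; apply Rinv_0_lt_compat, c_pos.
Qed.

Lemma travel_linear (k a b : R) : a <= b -> (forall y, a <= y <= b -> c y = k) ->
  travel b - travel a = (b - a) / k.
Proof.
  intros Hab E.
  assert (Hk : 0 < k) by (rewrite <- (E a) by lra; apply c_pos).
  enough (travel b = travel a + (b - a) / k) by lra.
  apply (eq_of_derive travel (fun y => travel a + (y - a) / k) (fun _ => / k) a b Hab).
  - intros y Hy; rewrite <- (E y Hy); apply travel_derive.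
  - intros y _. auto_derive; [lra|field; lra].
  - field; lra.
Qed.

(* [Z' / (2 Z)] in terms of [K' rho + K rho' = 2 Z Z'], extended to the line by its
   boundary values. *)
Definition refl (x : R) : R :=
  let y := clamp 0 xp x in (dK y * rho y + K y * drho y) / (4 * (K y * rho y)).

Lemma cts_refl : cts refl.
Proof.
  assert (Cl : cts (clamp 0 xp)) by (unfold clamp; ctsx).
  assert (CK : cts (fun x => K (clamp 0 xp x))) by (apply (cts_comp K); [apply cts_K|exact Cl]).
  assert (CR : cts (fun x => rho (clamp 0 xp x))) by (apply (cts_comp rho); [apply cts_rho|exact Cl]).
  unfold refl, Rdiv. apply cts_mult.
  - apply cts_plus; apply cts_mult; try assumption; apply cts_cont_on; (lra || assumption).
  - apply cts_inv; [|ctsx].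
    intros x. assert (H1 := K_pos (clamp 0 xp x)). assert (H2 := rho_pos (clamp 0 xp x)). nra.
Qed.

(** By uniqueness of the derivative [dZ] is the one computed from K' and rho'. On the open interval
    [deriv_on] is two-sided. *)
Lemma rf_refl (x : R) : 0 < x < xp -> rf K rho dZ x = refl x.
Proof.
  intros Hx. unfold rf, refl; rewrite clamp_id by lra.
  assert (HK := K_pos x). assert (Hr := rho_pos x). assert (HZ := Z_pos x).
  assert (D1 := deriv_on_interior _ _ _ _ x Z_deriv Hx).
  assert (D2 : is_derive Z x ((dK x * rho x + K x * drho x) / (2 * Z x))).
  { assert (DK := deriv_on_interior _ _ _ _ x K_deriv Hx).
    assert (Dr := deriv_on_interior _ _ _ _ x rho_deriv Hx).
    unfold Zf. auto_derive.
    - split; [eexists; exact DK|split; [eexists; exact Dr|split; [nra|trivial]]].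
    - replace (Derive (fun x => K x) x) with (dK x) by (symmetry; apply is_derive_unique, DK).
      replace (Derive (fun x => rho x) x) with (drho x) by (symmetry; apply is_derive_unique, Dr).
      field. apply Rgt_not_eq, HZ. }
  assert (E : dZ x = (dK x * rho x + K x * drho x) / (2 * Z x)).
  { rewrite <- (is_derive_unique _ _ _ D1). apply is_derive_unique, D2. }
  assert (E2 : Z x * Z x = K x * rho x) by (apply sqrt_sqrt; nra).
  rewrite E, <- E2. field. lra.
Qed.

(* Right-going (sigma = 1) and left-going (sigma = -1) Riemann invariants, frozen
   at their initial values for negative times. *)
Definition riemann (sigma x t : R) : R :=
  (p x (Rmax t 0) / sqrt (Z x) + sigma * (sqrt (Z x) * u x (Rmax t 0))) / 2.

Lemma cts2_nonneg_time (f : R -> R -> R) :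
  (forall x t, 0 <= t -> cont2_at (fun _ s => 0 <= s) f x t) ->
  cts2 (fun x t => f x (Rmax t 0)).
Proof.
  intros Hf [x t]. apply filterlim_locally; intros eps.
  destruct (Hf x (Rmax t 0) (Rmax_r t 0) eps (cond_pos eps)) as [d [Hd H]].
  exists (mkposreal d Hd); intros [x' t'] [H1 H2]. simpl in *.
  apply H; [apply Rmax_r|exact H1|].
  change (Rabs (t' - t) < d) in H2. eapply Rle_lt_trans; [|exact H2].
  unfold Rmax, Rabs; destruct (Rle_dec t' 0), (Rle_dec t 0); repeat destruct (Rcase_abs _); lra.
Qed.

Lemma sqrtZ_pos (x : R) : 0 < sqrt (Z x).
Proof. apply sqrt_lt_R0, Z_pos. Qed.

Lemma cts2_riemann (sigma : R) : cts2 (riemann sigma).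
Proof.
  assert (CS : cts (fun z : R * R => sqrt (Z (fst z)))).
  { apply cts_sqrt, (cts_comp Z); [apply cts_Z|ctsx]. }
  unfold cts2, riemann, Rdiv. apply cts_mult; [|ctsx]. apply cts_plus.
  - apply cts_mult; [apply (cts2_nonneg_time p p_cont)|].
    apply cts_inv; [intros z; apply Rgt_not_eq, sqrtZ_pos|exact CS].
  - apply cts_mult; [ctsx|]. apply cts_mult; [exact CS|apply (cts2_nonneg_time u u_cont)].
Qed.

Lemma riemann_zero (sigma x t : R) : 0 <= x -> t <= 0 -> riemann sigma x t = 0.
Proof.
  intros Hx Ht; unfold riemann. rewrite Rmax_right, init_p, init_u, p0_zero by assumption.
  unfold Rdiv; ring.
Qed.

(** The system cancels all derivatives of p and u along the characteristic. What remains comes from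
    differentiating sqrt Z and 1 / sqrt Z, whose opposite signs turn the invariant into the one of
    the other direction. *)
Lemma riemann_along (sigma s0 y z' : R) :
  sigma * sigma = 1 -> 0 < s0 + sigma * travel y -> is_derive Z y z' ->
  is_derive (fun x => riemann sigma x (s0 + sigma * travel x)) y
    (- (z' / (2 * Z y)) * riemann (- sigma) y (s0 + sigma * travel y)).
Proof.
  intros Hs Hpos DZ.
  set (s := fun x => s0 + sigma * travel x).
  assert (Ds : is_derive s y (sigma * / c y)).
  { unfold s. auto_derive; [eexists; apply travel_derive|].
    replace (Derive (fun x => travel x) y) with (/ c y) by (symmetry; apply is_derive_unique, travel_derive).
    ring. }
  assert (DP := is_derive_along p px pt s y _ p_t p_x px_cont Hpos Ds).
  assert (DU := is_derive_along u ux ut s y _ u_t u_x ux_cont Hpos Ds).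
  assert (HZ := Z_pos y). assert (HS := sqrtZ_pos y). assert (Hc := c_pos y).
  apply (is_derive_ext_loc (fun x => (p x (s x) / sqrt (Z x) + sigma * (sqrt (Z x) * u x (s x))) / 2)).
  (* Time stays positive near y, so the freezing by [Rmax] is invisible to the derivative. *)
  { assert (L : locally y (fun x => 0 < s x)).
    { assert (Cs : continuous s y) by (apply (ex_derive_continuous (V := R_NormedModule)); eexists; exact Ds).
      apply (Cs (fun v => 0 < v)). exists (mkposreal _ Hpos); intros v Hv.
      change (Rabs (v - s y) < s y) in Hv. apply Rabs_def2 in Hv. lra. }
    revert L; apply filter_imp; intros x Hx. unfold riemann; fold (s x). rewrite Rmax_left by lra. reflexivity. }
  set (P := fun x => p x (s x)) in *. set (U := fun x => u x (s x)) in *.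
  change (is_derive (fun x => (P x / sqrt (Z x) + sigma * (sqrt (Z x) * U x)) / 2) y
    (- (z' / (2 * Z y)) * riemann (- sigma) y (s y))).
  unfold riemann. rewrite Rmax_left by (left; exact Hpos). fold (P y) (U y).
  set (ZZ := Z) in *.
  auto_derive.
  - repeat split; try exact HZ; try lra; eexists; eassumption.
  - replace (Derive (fun x => P x) y) with (px y (s y) + pt y (s y) * (sigma * / c y))
      by (symmetry; apply is_derive_unique, DP).
    replace (Derive (fun x => U x) y) with (ux y (s y) + ut y (s y) * (sigma * / c y))
      by (symmetry; apply is_derive_unique, DU).
    replace (Derive (fun x => ZZ x) y) with z' by (symmetry; apply is_derive_unique, DZ).
    assert (E1 : pt y (s y) * / c y = - (ZZ y * ux y (s y))).
    { assert (E := eq_p y (s y) Hpos). rewrite <- Z_c in E.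
      replace (pt y (s y)) with (- (ZZ y * c y * ux y (s y))) by (unfold ZZ; lra). field; lra. }
    assert (E2 : ut y (s y) * / c y = - (px y (s y) / ZZ y)).
    { assert (E := eq_u y (s y) Hpos). rewrite <- c_div_Z in E.
      replace (ut y (s y)) with (- (c y / ZZ y * px y (s y))) by (unfold ZZ; lra). field; lra. }
    replace (px y (s y) + pt y (s y) * (sigma * / c y))
      with (px y (s y) + sigma * (pt y (s y) * / c y)) by ring.
    replace (ux y (s y) + ut y (s y) * (sigma * / c y))
      with (ux y (s y) + sigma * (ut y (s y) * / c y)) by ring.
    rewrite E1, E2.
    assert (HSS : ZZ y = sqrt (ZZ y) * sqrt (ZZ y)) by (symmetry; apply sqrt_sqrt; lra).
    change (Zf K rho y) with (ZZ y).
    set (S := sqrt (ZZ y)) in *. rewrite HSS.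
    set (A := px y (s y)). set (B := ux y (s y)).
    assert (Hs2 : sigma * sigma - 1 = 0) by lra.
    apply Rminus_diag_uniq. clear -HS Hs2.
    (* The u_x terms cancel for every sigma; the p_x terms leave this multiple of sigma^2 - 1. *)
    transitivity (- (sigma * sigma - 1) * A / (2 * S)); [field; lra|rewrite Hs2; field; lra].
Qed.

Lemma cts_riemann_along (sigma tt s0 : R) : cts (fun x => riemann sigma x (s0 + tt * travel x)).
Proof.
  apply (cts_comp2 (riemann sigma)); [apply cts2_riemann|ctsx|].
  apply cts_plus; [ctsx|apply cts_mult; [ctsx|apply cts_travel]].
Qed.

(** Here Z is locally constant, so nothing is exchanged. Positivity is asked only inside the
    interval: an endpoint may lie at time 0 or at a corner of Z, and continuity covers it. *)
Lemma riemann_outside (sigma s0 a b : R) :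
  sigma * sigma = 1 -> a <= b -> b <= 0 \/ xp <= a ->
  (forall y, a < y < b -> 0 < s0 + sigma * travel y) ->
  riemann sigma a (s0 + sigma * travel a) = riemann sigma b (s0 + sigma * travel b).
Proof.
  intros Hs Hab Hout Hpos.
  apply (const_except (fun x => riemann sigma x (s0 + sigma * travel x)) a b b Hab); [apply cts_riemann_along|].
  intros y Hy _.
  replace 0 with (- (0 / (2 * Z y)) * riemann (- sigma) y (s0 + sigma * travel y))
    by (unfold Rdiv; ring).
  apply riemann_along; [exact Hs|apply Hpos, Hy|].
  apply (is_derive_ext_loc (fun _ => Z y)); [|apply (is_derive_const (V := R_NormedModule))].
  assert (P : 0 < Rmin (y - a) (b - y)) by (apply Rmin_pos; lra).
  exists (mkposreal _ P); intros x Hx. change (Rabs (x - y) < Rmin (y - a) (b - y)) in Hx.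
  assert (M1 := Rmin_l (y - a) (b - y)). assert (M2 := Rmin_r (y - a) (b - y)).
  apply Rabs_def2 in Hx. unfold Zf.
  destruct Hout as [H|H].
  - destruct (left_const x ltac:(lra)) as [E1 E2], (left_const y ltac:(lra)) as [E3 E4].
    rewrite E1, E2, E3, E4; reflexivity.
  - destruct (right_const x ltac:(lra)) as [E1 E2], (right_const y ltac:(lra)) as [E3 E4].
    rewrite E1, E2, E3, E4; reflexivity.
Qed.

(** No sign of the time is assumed. [travel] is strictly increasing, so the path meets t = 0 at most
    once; before that both invariants vanish and the equation is trivial, after that [riemann_along]
    applies. *)
Lemma riemann_inside (sigma s0 a b : R) :
  sigma * sigma = 1 -> 0 <= a <= b -> b <= xp ->
  riemann sigma a (s0 + sigma * travel a) = riemann sigma b (s0 + sigma * travel b) +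
    RInt (fun y => refl y * riemann (- sigma) y (s0 + sigma * travel y)) a b.
Proof.
  intros Hs Hab Hb.
  assert (CI : cts (fun y => refl y * riemann (- sigma) y (s0 + sigma * travel y))).
  { apply cts_mult; [apply cts_refl|apply cts_riemann_along]. }
  set (I := fun q => RInt (fun y => refl y * riemann (- sigma) y (s0 + sigma * travel y)) a q).
  assert (DI : forall q, is_derive I q (refl q * riemann (- sigma) q (s0 + sigma * travel q))).
  { intros q; apply (is_derive_RInt_cts (fun y => refl y * riemann (- sigma) y (s0 + sigma * travel y))), CI. }
  assert (Ia : I a = 0) by apply (RInt_point (V := R_CompleteNormedModule)).
  assert (Hzero : exists k, forall y, y <> k -> s0 + sigma * travel y <> 0).
  { destruct (classic (exists k, s0 + sigma * travel k = 0)) as [[k Hk]|N].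
    - exists k; intros y Hy E.
      assert (sigma <> 0) by (intros ->; lra).
      assert (T : travel y = travel k) by (apply (Rmult_eq_reg_l sigma); lra).
      destruct (Rtotal_order y k) as [L|[L|L]]; [apply travel_lt in L|contradiction|apply travel_lt in L]; lra.
    - exists 0; intros y _ E; apply N; exists y; exact E. }
  destruct Hzero as [k Hk].
  assert (E : riemann sigma a (s0 + sigma * travel a) + I a = riemann sigma b (s0 + sigma * travel b) + I b).
  { apply (const_except (fun x => riemann sigma x (s0 + sigma * travel x) + I x) a b k); [lra| |].
    - apply cts_plus; [apply cts_riemann_along|].
      intros y; apply (ex_derive_continuous (V := R_NormedModule)); eexists; apply DI.
    - intros y Hy Hyk.
      assert (D : is_derive (fun x => riemann sigma x (s0 + sigma * travel x)) y
          (- (refl y * riemann (- sigma) y (s0 + sigma * travel y)))).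
      { destruct (Rlt_dec 0 (s0 + sigma * travel y)) as [Hpos|Hneg].
        - replace (- (refl y * riemann (- sigma) y (s0 + sigma * travel y))) with
            (- (dZ y / (2 * Z y)) * riemann (- sigma) y (s0 + sigma * travel y)).
          + apply riemann_along; [exact Hs|exact Hpos|].
            apply (deriv_on_interior Z dZ 0 xp y Z_deriv). lra.
          + fold (rf K rho dZ y). rewrite rf_refl by lra. ring.
        - assert (Hlt : s0 + sigma * travel y < 0) by (assert (N := Hk y Hyk); lra).
          rewrite riemann_zero by lra. rewrite Rmult_0_r, Ropp_0.
          apply (is_derive_ext_loc (fun _ => 0)); [|apply (is_derive_const (V := R_NormedModule))].
          assert (L1 : locally y (fun x => s0 + sigma * travel x < 0)).
          { assert (Cs : cts (fun x => s0 + sigma * travel x))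
              by (apply cts_plus; [ctsx|apply cts_mult; [ctsx|apply cts_travel]]).
            apply (Cs y (fun v => v < 0)).
            assert (Q : 0 < - (s0 + sigma * travel y)) by lra.
            exists (mkposreal _ Q); intros v Hv.
            change (Rabs (v - (s0 + sigma * travel y)) < - (s0 + sigma * travel y)) in Hv.
            apply Rabs_def2 in Hv. lra. }
          assert (L2 : locally y (fun x => 0 < x)).
          { assert (Q : 0 < y) by lra.
            exists (mkposreal _ Q); intros v Hv.
            change (Rabs (v - y) < y) in Hv. apply Rabs_def2 in Hv. lra. }
          generalize (filter_and _ _ L1 L2); apply filter_imp.
          intros x [H1 H2]. symmetry; apply riemann_zero; lra. }
      replace 0 with (- (refl y * riemann (- sigma) y (s0 + sigma * travel y)) +
        refl y * riemann (- sigma) y (s0 + sigma * travel y)) by ring.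
      apply (is_derive_plus (V := R_NormedModule) (fun x => riemann sigma x (s0 + sigma * travel x)) I);
        [exact D|apply DI]. }
  rewrite Ia, Rplus_0_r in E. exact E.
Qed.

(** * Boundary values of the invariants and the Volterra system *)

Definition entry (s : R) : R := p0 (- c_m * s) / sqrt Z_m.

Lemma cts_entry : cts entry.
Proof.
  unfold entry, Rdiv. apply cts_mult; [|ctsx].
  apply (cts_comp p0); [exact p0_cts|ctsx].
Qed.

Lemma c_m_pos : 0 < c_m.
Proof. rewrite <- (c_left 0) by lra. apply c_pos. Qed.

Lemma riemann_entry (s : R) : riemann 1 0 s = entry s.
Proof.
  assert (Hc := c_m_pos). unfold entry.
  destruct (Rle_dec s 0) as [H|H].
  { rewrite riemann_zero by lra. rewrite p0_zero by nra. unfold Rdiv; ring. }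
  (* The point where the right-going characteristic through (0, s) left the line t = 0. *)
  set (a := - c_m * s). assert (Ha : a < 0) by (unfold a; nra).
  assert (Ta : travel a = - s).
  { assert (T := travel_linear c_m a 0 ltac:(lra) ltac:(intros; apply c_left; lra)).
    rewrite travel_0 in T. replace ((0 - a) / c_m) with s in T by (unfold a; field; lra). lra. }
  assert (E := riemann_outside 1 s a 0 ltac:(lra) ltac:(lra) ltac:(lra)).
  rewrite travel_0, Ta in E.
  replace (s + 1 * - s) with 0 in E by ring. replace (s + 1 * 0) with s in E by ring.
  rewrite <- E.
  - unfold riemann. rewrite Rmax_right, init_p, init_u, Z_left by lra. fold a.
    assert (HZ : 0 < Z_m) by (rewrite <- (Z_left 0) by lra; apply Z_pos).
    assert (HS : 0 < sqrt Z_m) by (apply sqrt_lt_R0, HZ).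
    assert (HSS : Z_m = sqrt Z_m * sqrt Z_m) by (symmetry; apply sqrt_sqrt; lra).
    set (S := sqrt Z_m) in *. rewrite HSS. field. lra.
  - intros y Hy. assert (T := travel_lt a y ltac:(lra)). lra.
Qed.

Lemma riemann_exit (s : R) : riemann (-1) xp s = 0.
Proof.
  assert (Hc : 0 < cm Kp rp) by (rewrite <- (c_right xp) by lra; apply c_pos).
  destruct (Rle_dec s 0) as [H|H]; [apply riemann_zero; lra|].
  (* The left-going characteristic through (xp, s) started here at time 0, where the data vanish. *)
  set (b := xp + cm Kp rp * s). assert (Hb : xp < b) by (unfold b; nra).
  assert (Tb : travel b - travel xp = s).
  { rewrite (travel_linear (cm Kp rp)); [unfold b; field; lra|lra|intros; apply c_right; lra]. }
  assert (E := riemann_outside (-1) (s + travel xp) xp b ltac:(lra) ltac:(lra) ltac:(lra)).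
  replace (s + travel xp + -1 * travel xp) with s in E by ring.
  replace (s + travel xp + -1 * travel b) with 0 in E by lra.
  rewrite E; [apply riemann_zero; lra|].
  intros y Hy. assert (T := travel_lt y b ltac:(lra)). lra.
Qed.

Lemma riemann_right_eq (x t : R) : 0 <= x <= xp ->
  riemann 1 x t = entry (t - travel x) + right_op travel refl (riemann (-1)) x t.
Proof.
  intros Hx. rewrite <- riemann_entry.
  assert (E := riemann_inside 1 (t - travel x) 0 x ltac:(lra) ltac:(lra) ltac:(lra)).
  rewrite travel_0 in E.
  replace (t - travel x + 1 * 0) with (t - travel x) in E by ring.
  replace (t - travel x + 1 * travel x) with t in E by ring.
  rewrite E. unfold right_op.
  rewrite (RInt_ext_R (fun y => refl y * riemann (- 1) y (t - travel x + 1 * travel y))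
    (fun y => refl y * riemann (-1) y (t - travel x + travel y))).
  - ring.
  - intros y _. rewrite Rmult_1_l. reflexivity.
Qed.

Lemma riemann_left_eq (x t : R) : 0 <= x <= xp ->
  riemann (-1) x t = left_op xp travel refl (riemann 1) x t.
Proof.
  intros Hx.
  assert (E := riemann_inside (-1) (t + travel x) x xp ltac:(lra) ltac:(lra) ltac:(lra)).
  replace (t + travel x + -1 * travel x) with t in E by ring.
  rewrite riemann_exit, Rplus_0_l in E. rewrite E. unfold left_op.
  apply RInt_ext_R; intros y _. replace (- -1) with 1 by ring.
  replace (t + travel x + -1 * travel y) with (t - travel y + travel x) by ring. reflexivity.
Qed.

(** * Return to the pressure and to the terms w^1 and w^2 *)

Lemma p_decomposition (x t : R) : 0 <= t ->
  p x t = sqrt (Z x) * riemann (-1) x t + sqrt (Z x) * riemann 1 x t.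
Proof.
  intros Ht; unfold riemann. rewrite Rmax_left by lra. assert (HS := sqrtZ_pos x). field. lra.
Qed.

Lemma tauf_travel (x : R) : tauf K rho x = travel x.
Proof. apply (Rint_cts (fun s => / c s)); [apply cts_inv_c|reflexivity]. Qed.

Lemma tauf_eq : tauf K rho = travel.
Proof. apply functional_extensionality, tauf_travel. Qed.

(** Together with [p0_entry] it trades C_G p0 for sqrt Z times [entry], the normalization of the
    invariants. *)
Lemma CG_eq (x : R) : CG K rho Km rm x * sqrt Z_m = sqrt (Z x).
Proof.
  assert (HZ : 0 < Z_m) by (rewrite <- (Z_left 0) by lra; apply Z_pos).
  assert (HS := sqrt_lt_R0 _ HZ). assert (Hx := Z_pos x).
  unfold CG. rewrite sqrt_div by lra. field. lra.
Qed.

Lemma p0_entry (s : R) : p0 (- c_m * s) = sqrt Z_m * entry s.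
Proof.
  assert (HZ : 0 < Z_m) by (rewrite <- (Z_left 0) by lra; apply Z_pos).
  assert (HS := sqrt_lt_R0 _ HZ). unfold entry. field. lra.
Qed.

Lemma w1_left_term (m : nat) (x t : R) : 0 <= x <= xp ->
  w1 K rho Km rm xp dZ p0 m x t = sqrt (Z x) * left_term xp travel refl entry m x t.
Proof.
  assert (Ct := cts_travel). assert (Cr := cts_refl). assert (Cp := cts_entry).
  intros Hx. unfold w1, left_term. rewrite tauf_eq.
  assert (C1 : cts2 (left_kernel xp travel refl entry x t)).
  { apply cts_left_kernel; ctsx. }
  rewrite (alt_iter_alt xp travel refl cts_travel cts_refl (rf K rho dZ) rf_refl (2 * m) 1 _
    (fun p s => sqrt Z_m * left_kernel xp travel refl entry x t p s)); [| |apply cts_mult; [ctsx|exact C1]|lra].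
  - rewrite <- alt_scal by assumption.
    rewrite <- CG_eq. ring.
  - intros q s k Hq; f_equal. unfold left_kernel. rewrite <- RInt_mult_l.
    + apply Rint_cts.
      * ctsx.
      * intros y Hy. rewrite p0_entry, rf_refl; [ring|].
        assert (H1 : Rmax x q <= xp) by (apply Rmax_lub; lra).
        rewrite Rmin_left, (Rmax_right (Rmax x q)) in Hy by exact H1.
        assert (H2 := Rmax_l x q). lra.
    + ctsx.
Qed.

Lemma w2_right_term (m : nat) (x t : R) : 0 <= x <= xp ->
  w2 K rho Km rm xp dZ p0 m x t = sqrt (Z x) * right_term xp travel refl entry m x t.
Proof.
  assert (Ct := cts_travel). assert (Cr := cts_refl). assert (Cp := cts_entry).
  intros Hx. destruct m as [|m]; unfold w2, right_term; rewrite tauf_eq.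
  { rewrite p0_entry, <- CG_eq. ring. }
  assert (C2 : cts2 (right_kernel travel refl entry x t)).
  { apply cts_right_kernel; ctsx. }
  replace (2 * S m - 1)%nat with (S (2 * m)) by lia.
  rewrite (alt_iter_alt xp travel refl cts_travel cts_refl (rf K rho dZ) rf_refl (S (2 * m)) 1 _
    (fun p s => sqrt Z_m * right_kernel travel refl entry x t p s)); [| |apply cts_mult; [ctsx|exact C2]|lra].
  - rewrite <- alt_scal by assumption.
    rewrite <- CG_eq. ring.
  - intros q s k Hq; f_equal. unfold right_kernel. rewrite <- RInt_mult_l.
    + apply Rint_cts.
      * ctsx.
      * intros y Hy. rewrite p0_entry, rf_refl; [ring|].
        assert (H1 : 0 <= Rmin x q) by (apply Rmin_glb; lra).
        rewrite (Rmin_left 0), Rmax_right in Hy by exact H1.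
        assert (H2 := Rmin_l x q). lra.
    + ctsx.
Qed.

(** At x = 0 the integral of [right_op] is over a single point; at [xp] the same happens to
    [left_op]. *)
Lemma w2_left (m : nat) (t : R) : w2 K rho Km rm xp dZ p0 (S m) 0 t = 0.
Proof.
  rewrite w2_right_term, right_term_rec by first [lra|apply cts_travel|apply cts_refl|apply cts_entry|assumption].
  unfold right_op. rewrite RInt_point. change (sqrt (Z 0) * - 0 = 0). ring.
Qed.

Lemma w1_right (m : nat) (t : R) : w1 K rho Km rm xp dZ p0 m xp t = 0.
Proof.
  rewrite w1_left_term, left_term_rec by first [lra|apply cts_travel|apply cts_refl|apply cts_entry|assumption].
  unfold left_op. rewrite RInt_point. apply Rmult_0_r.
Qed.

Lemma w2_0_left (t : R) : w2 K rho Km rm xp dZ p0 0 0 t = p0 (- c_m * t).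
Proof.
  assert (HZ : 0 < Z_m) by (rewrite <- (Z_left 0) by lra; apply Z_pos).
  unfold w2, CG. rewrite tauf_eq, travel_0, Z_left by lra.
  rewrite Rdiv_diag by lra. rewrite sqrt_1. replace (t - 0) with t by ring. ring.
Qed.

Lemma pressure_series (x t : R) : 0 <= x <= xp -> 0 <= t ->
  exists l1 l2,
    infinite_sum (fun m => w1 K rho Km rm xp dZ p0 m x t) l1 /\
    infinite_sum (fun m => w2 K rho Km rm xp dZ p0 m x t) l2 /\
    p x t = l1 + l2.
Proof.
  intros Hx Ht.
  assert (W : forall y s, 0 <= y <= xp -> s <= 0 -> riemann 1 y s = 0).
  { intros y s Hy; apply riemann_zero, Hy. }
  exists (sqrt (Z x) * riemann (-1) x t), (sqrt (Z x) * riemann 1 x t).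
  destruct (scattering_series xp travel refl entry xp_pos cts_travel cts_refl cts_entry c cts_c c_pos travel_derive
    (riemann 1) (riemann (-1)) (cts2_riemann 1) (cts2_riemann (-1))
    W
    riemann_right_eq riemann_left_eq x t Hx) as [S1 S2].
  split; [|split; [|apply p_decomposition, Ht]].
  - apply (infinite_sum_ext (fun m => sqrt (Z x) * left_term xp travel refl entry m x t)).
    + intros m; symmetry; apply w1_left_term, Hx.
    + apply infinite_sum_scal, S1.
  - apply (infinite_sum_ext (fun m => sqrt (Z x) * right_term xp travel refl entry m x t)).
    + intros m; symmetry; apply w2_right_term, Hx.
    + apply infinite_sum_scal, S2.
Qed.

End Characteristics.

Theorem mainTheorem7
  (xp : R) (K rho : R -> R) (Km rm Kp rp : R) (dK drho dZ : R -> R)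
  (p0 dp0 : R -> R)
  (p u pt px ut ux : R -> R -> R) :
  0 < xp ->
  (* coefficients *)
  (forall x, 0 < K x) -> (forall x, 0 < rho x) ->
  continuity K -> continuity rho ->
  (forall x, x < 0 -> K x = Km /\ rho x = rm) ->
  (forall x, xp < x -> K x = Kp /\ rho x = rp) ->
  deriv_on K dK 0 xp -> cont_on dK 0 xp ->
  deriv_on rho drho 0 xp -> cont_on drho 0 xp ->
  (* dZ is Z' on [0, xp] *)
  deriv_on (Zf K rho) dZ 0 xp ->
  (* initial datum p0 in C^1, p0 = 0 on [0,oo), p0 and p0' bounded *)
  (forall xi, derivable_pt_lim p0 xi (dp0 xi)) -> continuity dp0 ->
  (forall xi, 0 <= xi -> p0 xi = 0) ->
  (exists M, forall xi, Rabs (p0 xi) <= M) ->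
  (exists M, forall xi, Rabs (dp0 xi) <= M) ->
  (* (p,u) is the (classical, C^1) solution of the Cauchy problem *)
  (forall x t, 0 < t -> derivable_pt_lim (fun s => p x s) t (pt x t)) ->
  (forall x t, 0 < t -> derivable_pt_lim (fun y => p y t) x (px x t)) ->
  (forall x t, 0 < t -> derivable_pt_lim (fun s => u x s) t (ut x t)) ->
  (forall x t, 0 < t -> derivable_pt_lim (fun y => u y t) x (ux x t)) ->
  (forall x t, 0 < t ->
     cont2_at (fun _ s => 0 < s) pt x t /\ cont2_at (fun _ s => 0 < s) px x t /\
     cont2_at (fun _ s => 0 < s) ut x t /\ cont2_at (fun _ s => 0 < s) ux x t) ->
  (forall x t, 0 <= t ->
     cont2_at (fun _ s => 0 <= s) p x t /\ cont2_at (fun _ s => 0 <= s) u x t) ->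
  (forall x t, 0 < t -> pt x t + K x * ux x t = 0) ->
  (forall x t, 0 < t -> ut x t + / rho x * px x t = 0) ->
  (forall x, p x 0 = p0 x) ->
  (forall x, u x 0 = p0 x / Zm Km rm) ->
  (* conclusion *)
  forall t, 0 <= t ->
    (forall x, 0 <= x <= xp ->
       exists l1 l2,
         infinite_sum (fun m => w1 K rho Km rm xp dZ p0 m x t) l1 /\
         infinite_sum (fun m => w2 K rho Km rm xp dZ p0 m x t) l2 /\
         p x t = l1 + l2) /\
    infinite_sum (fun m => w1 K rho Km rm xp dZ p0 m 0 t)
      (p 0 t - p0 (- cm Km rm * t)) /\
    infinite_sum (fun m => w2 K rho Km rm xp dZ p0 m xp t) (p xp t).
Proof.
  intros Hxp HK Hr CK Cr HL HR DK dKc Dr drc DZ Dp0 _ Hp0 _ _ Pt Px Ut Ux C1 C0 E1 E2 I1 I2 t Ht.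
  assert (Cp0 : cts p0).
  { intros s. apply (ex_derive_continuous (V := R_NormedModule)).
    exists (dp0 s); apply is_derive_Reals, Dp0. }
  assert (Series : forall x, 0 <= x <= xp -> exists l1 l2,
      infinite_sum (fun m => w1 K rho Km rm xp dZ p0 m x t) l1 /\
      infinite_sum (fun m => w2 K rho Km rm xp dZ p0 m x t) l2 /\ p x t = l1 + l2).
  { intros x Hx.
    eapply (pressure_series xp K rho Km rm Kp rp dK drho dZ p0 p u pt px ut ux); try assumption;
      intros y s Hs; first [apply (C1 y s Hs)|apply (C0 y s Hs)]. }
  split; [exact Series|split].
  - destruct (Series 0 ltac:(lra)) as [l1 [l2 [S1 [S2 E]]]].
    (* At x = 0 the second series reduces to its term m = 0, the incoming wave, which is subtracted
       from p. *)
    assert (S3 := infinite_sum_singleton (fun m => w2 K rho Km rm xp dZ p0 m 0 t)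
      ltac:(intros m; eapply (w2_left xp K rho Km rm dK drho dZ); eassumption)).
    cbv beta in S3. erewrite w2_0_left in S3; try eassumption.
    rewrite E, (uniqueness_sum _ _ _ S2 S3).
    replace (l1 + p0 (- cm Km rm * t) - p0 (- cm Km rm * t)) with l1 by ring. exact S1.
  - destruct (Series xp ltac:(lra)) as [l1 [l2 [S1 [S2 E]]]].
    assert (W : forall m, w1 K rho Km rm xp dZ p0 m xp t = 0).
    { intros m; eapply (w1_right xp K rho Km rm dK drho dZ); eassumption. }
    (* At [xp] every term of the first series vanishes, term 0 included, so its sum is 0. *)
    assert (S3 := infinite_sum_singleton (fun m => w1 K rho Km rm xp dZ p0 m xp t) (fun m => W (S m))).
    cbv beta in S3. rewrite W in S3.
    rewrite E, (uniqueness_sum _ _ _ S1 S3), Rplus_0_l. exact S2.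
Qed.
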